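(* Let $n\ge 4$ and let $M^n$ be an $n$-dimensional connected Riemannian manifold with constant Ricci eigenvalues which is not curvature homogeneous. Then, for every $c\in\mathbb{R}$, there is no isometric immersion of $M^n$ into the real space form $\mathbb{Q}_c^{n+1}$ of constant sectional curvature $c$.
   Context: $\mathbb{Q}_c^{n+1}$ denotes the simply connected real space form of dimension $n+1$ and constant sectional curvature $c$ (a round sphere, Euclidean space, or a hyperbolic space). Everything is smooth. A Riemannian manifold $M$ is called curvature homogeneous if for any two points $p,q\in M$ there exists a linear isometry $J_{pq}\colon T_pM\to T_qM$ with $J_{pq}^{*}R_q=R_p$, where $R$ is the Riemann curvature tensor. The Ricci eigenvalues of $M$ at $p$ are the eigenvalues of the self-adjoint Ricci operator $\widehat{\mathrm{Ric}}_p\colon T_pM\to T_pM$ defined by $g(\widehat{\mathrm{Ric}}(X),Y)=\mathrm{Ric}(X,Y)$. $M$ has constant Ricci eigenvalues if these eigenvalues, counted with multiplicity, do not depend on the point $p\in M$. *)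

(* Defs.v *)
From mathcomp Require Import all_boot all_order all_algebra.
From mathcomp Require Import all_classical all_reals all_analysis.

Set Implicit Arguments.
Unset Strict Implicit.
Unset Printing Implicit Defensive.

Import Order.TTheory GRing.Theory Num.Theory.
Import numFieldNormedType.Exports.

Local Open Scope classical_set_scope.
Local Open Scope ring_scope.

(* [U] is meant to be open.  Quantifying over all directions [v], rather than
   over a basis, lets the definition apply to any pair of normed spaces. *)
Fixpoint Ck (R : realType) (V W : normedModType R) (k : nat) (U : set V)
    (f : V -> W) : Prop :=
  match k with
  | 0 => forall x, U x -> {for x, continuous f}
  | k'.+1 => (forall x, U x -> differentiable f x) /\
             (forall v : V, Ck k' U (fun x => 'D_v f x))
  end.

Definition smooth_on (R : realType) (V W : normedModType R) (U : set V)
    (f : V -> W) : Prop :=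
  forall k, Ck k U f.

(* The functions [coord a] and [param a] are total, but only their restrictions
   to [dom a] and to [coord a @` dom a] matter; there they are inverse
   homeomorphisms. *)
Record smoothManifold (R : realType) (n : nat) := SmoothManifold {
  carrier :> topologicalType;
  chart : Type;
  dom : chart -> set carrier;
  coord : chart -> carrier -> 'rV[R]_n;
  param : chart -> 'rV[R]_n -> carrier;
  carrier_hausdorff : hausdorff_space carrier;
  carrier_second_countable : @second_countable carrier;
  dom_open : forall a, open (dom a);
  dom_cover : forall p, exists a, dom a p;
  coord_open : forall a, open (coord a @` dom a);
  coordK : forall a p, dom a p -> param a (coord a p) = p;
  coord_continuous : forall a p, dom a p -> {for p, continuous (coord a)};
  param_continuous : forall a x,
    (coord a @` dom a) x -> {for x, continuous (param a)};
  transition_smooth : forall a b,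
    smooth_on (coord a @` (dom a `&` dom b)) (coord b \o param a)
}.

(* A tangent vector at [p \in dom a] is given by the row of its components in
   the coordinate basis d/dx_1, ..., d/dx_n of the chart [a]; a linear map is a
   matrix acting on rows from the right. In particular ['J f x] has entries
   ('J f x) i k = d f_k / d x_i. *)
Definition bform (R : realType) (n : nat) (B : 'M[R]_n) (u v : 'rV[R]_n) : R :=
  (u *m B *m v^T) 0 0.

Record riemannianMetric (R : realType) (n : nat) (M : smoothManifold R n) :=
  RiemannianMetric {
  metric :> chart M -> 'rV[R]_n -> 'M[R]_n;
  metric_smooth : forall a, smooth_on (coord a @` dom a) (metric a);
  metric_sym : forall a x, (coord a @` dom a) x -> (metric a x)^T = metric a x;
  metric_posdef : forall a x, (coord a @` dom a) x ->
    forall v, v != 0 -> 0 < bform (metric a x) v v;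
  metric_transition : forall a b x, (coord a @` (dom a `&` dom b)) x ->
    let tau := coord b \o param a in
    metric a x = 'J tau x *m metric b (tau x) *m ('J tau x)^T
}.

Section LocalCurvature.
Variables (R : realType) (n : nat) (G : 'rV[R]_n -> 'M[R]_n).

Definition dmetric (x : 'rV[R]_n) (i j k : 'I_n) : R :=
  'D_('e_i) (fun y => G y j k) x.

(* Gamma^k_{ij} of the Levi-Civita connection. *)
Definition christoffel (k i j : 'I_n) (x : 'rV[R]_n) : R :=
  2^-1 * \sum_(l < n) invmx (G x) k l *
    (dmetric x i j l + dmetric x j i l - dmetric x l i j).

(* The d/dx_l component of R(d/dx_i, d/dx_j) d/dx_k, where
   R(X,Y)Z = nabla_X nabla_Y Z - nabla_Y nabla_X Z - nabla_[X,Y] Z. *)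
Definition riemann (x : 'rV[R]_n) (i j k l : 'I_n) : R :=
  'D_('e_i) (christoffel l j k) x - 'D_('e_j) (christoffel l i k) x
  + \sum_(m < n) (christoffel l i m x * christoffel m j k x
                  - christoffel l j m x * christoffel m i k x).

(* g(R(u,v)w, z) *)
Definition curvature_tensor (x : 'rV[R]_n) (u v w z : 'rV[R]_n) : R :=
  \sum_(i < n) \sum_(j < n) \sum_(k < n) \sum_(l < n) \sum_(m < n)
    u 0 i * v 0 j * w 0 k * riemann x i j k l * G x l m * z 0 m.

(* Ric(X,Y) = trace (Z |-> R(Z,X)Y) *)
Definition ricci (x : 'rV[R]_n) : 'M[R]_n :=
  \matrix_(j, k) \sum_(i < n) riemann x i j k i.

(* The only matrix A with (u *m A) *m G x *m v^T = u *m ricci x *m v^T. *)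
Definition ricci_operator (x : 'rV[R]_n) : 'M[R]_n :=
  ricci x *m invmx (G x).

End LocalCurvature.

Definition curvature_homogeneous (R : realType) (n : nat)
    (M : smoothManifold R n) (g : riemannianMetric M) : Prop :=
  forall (p q : M) (a b : chart M), dom a p -> dom b q ->
  exists J : 'M[R]_n,
    (forall u v, bform (g b (coord b q)) (u *m J) (v *m J)
               = bform (g a (coord a p)) u v) /\
    (forall u v w z,
       curvature_tensor (g b) (coord b q) (u *m J) (v *m J) (w *m J) (z *m J)
       = curvature_tensor (g a) (coord a p) u v w z).

(* The Ricci operator is self-adjoint, so the multiplicity of an eigenvalue is
   the dimension of its eigenspace; non-eigenvalues have multiplicity 0. *)
Definition constant_ricci_eigenvalues (R : realType) (n : nat)
    (M : smoothManifold R n) (g : riemannianMetric M) : Prop :=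
  forall (p q : M) (a b : chart M), dom a p -> dom b q ->
  forall lam : R,
    \rank (eigenspace (ricci_operator (g a) (coord a p)) lam)
    = \rank (eigenspace (ricci_operator (g b) (coord b q)) lam).

(* Gram matrix of the ambient space of the [m]-dimensional space form:
   Euclidean if 0 <= c, Lorentzian if c < 0. *)
Definition ambient_form (R : realType) (m : nat) (c : R) : 'M[R]_m.+1 :=
  diag_mx (\row_(i < m.+1) if (i == ord0) && (c < 0) then -1 else 1).

(* The [m]-dimensional simply connected space form (for 2 <= m) of curvature
   [c], as a hypersurface of R^{m+1}: the hyperplane x_0 = 0 if c = 0, the round
   sphere of radius 1/sqrt c if 0 < c, the upper sheet of the hyperboloid
   <x,x> = 1/c if c < 0.  Its metric is the restriction of [ambient_form]. *)
Definition space_form (R : realType) (m : nat) (c : R) : set 'rV[R]_m.+1 :=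
  [set x : 'rV[R]_m.+1 | if c == 0 then x 0 ord0 = 0
           else bform (ambient_form m c) x x = c^-1 /\
                (c < 0 -> 0 < x 0 ord0)].
Arguments space_form {R} m c.

(* Since [space_form m c] is an embedded submanifold, a map into it is smooth
   if and only if it is smooth as a map into R^{m+1}. *)
Definition isometric_immersion (R : realType) (n m : nat)
    (M : smoothManifold R n) (g : riemannianMetric M) (c : R)
    (f : M -> 'rV[R]_m.+1) : Prop :=
  (forall p, space_form m c (f p)) /\
  forall a : chart M,
    let F := f \o param a in
    smooth_on (coord a @` dom a) F /\
    forall x, (coord a @` dom a) x ->
      row_free ('J F x) /\
      'J F x *m ambient_form m c *m ('J F x)^T = g a x.

(* Main.v *)
From Pilot Require Import Defs.
From mathcomp Require Import all_boot all_order all_algebra.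
From mathcomp Require Import fingroup perm.
From mathcomp Require Import all_classical all_reals all_analysis.
From mathcomp Require Import complex polyrcf spectral.
From mathcomp Require Import ring lra zify.
Import Order.TTheory GRing.Theory Num.Theory.
Import numFieldNormedType.Exports.
Local Open Scope ring_scope.

(** Suppose that the manifold is immersed isometrically as a hypersurface of the
    space form of curvature c, with shape operator A, principal curvatures
    d_1, ..., d_n, and H = d_1 + ... + d_n.

    _What the hypothesis says._  By the Gauss equation ([gauss_equation],
    [lowered_riemann]) the curvature tensor is the one of constant curvature c
    plus a term quadratic in A.  Taking traces, the Ricci operator is
    (n - 1) c + H A - A^2, so that constancy of its eigenvalues means that the
    numbers mu_i = d_i (H - d_i) are the same at all points, up to order
    ([spectra_ricci_part]).

    _What has to be shown._  In an orthonormal frame of principal directions the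
    quadratic term only involves the products d_i d_j with i <> j.  Hence two
    points whose principal curvatures can be numbered so that these products
    agree have isometric curvature tensors ([same_type_isometry]), and it
    suffices to see that the products do not vary over the manifold: then it
    is curvature homogeneous, contrary to assumption.

    _Algebra._  Since (2 d_i - H)^2 = H^2 - 4 mu_i, the equation H = sum d_i is a
    relation (n - 2) H + sum (+- sqrt (H^2 - 4 mu_i)) = 0.  The functions
    sqrt (t - m), for distinct m, are linearly independent in the strong sense
    that a nontrivial relation between them holds for finitely many t only
    ([finitely_many_root_relations]).  A trivial relation forces all but two of
    the d_i to vanish, because the terms with mu_i = 0 have to cancel (n - 2) H.
    So either (d_i) lies in a finite set, or only two principal curvatures, say
    d_1 and d_2, can be nonzero.  In the second case H is free, but the only
    product left is d_1 d_2 = (sum mu_i) / 2, which is determined.  Altogether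
    the possible types of curvature are isolated from each other
    ([locally_unique_type]).

    _Topology._  The second fundamental form is continuous up to its sign, hence
    so is the characteristic polynomial of A; as types are isolated, the type is
    locally constant ([spectrum_locally_constant]), and the manifold is
    connected. *)

Set Implicit Arguments.
Unset Strict Implicit.
Unset Printing Implicit Defensive.

(** * Relations between square roots *)
Section RootRelations.
Variable R : rcfType.

Definition signed_sums (l : seq R) : seq R :=
  foldr (fun w s => map (+%R w) s ++ map (+%R (- w)) s) [:: 0] l.

Lemma sum_in_signed_sums (l : seq R) : \sum_(w <- l) w \in signed_sums l.
Proof.
elim: l => [|w l IH]; first by rewrite big_nil mem_seq1.
by rewrite big_cons /= mem_cat map_f.
Qed.

(** The powers of w in q(z + c w) are reduced to 1 and w by w^2 = t - m.  The
    coefficients do not depend on the choice of the root w, so that the same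
    pair describes q(z - c w). *)
Lemma even_odd_shift (c m : R) (q : {poly {poly R}}) :
  exists ev od : {poly {poly R}}, forall t w z : R, w ^+ 2 = t - m ->
    q.[(z + c * w)%:P].[t] = ev.[z%:P].[t] + w * od.[z%:P].[t].
Proof.
elim/poly_ind: q => [|q a [ev [od IH]]].
  by exists 0, 0 => t w z _; rewrite !hornerE ?mulr0 ?addr0.
exists (ev * 'X + (c *: ('X - m%:P))%:P * od + a%:P), (od * 'X + c%:P%:P * ev).
move=> t w z hw; rewrite !hornerE IH //.
rewrite -hw; ring.
Qed.

(** The product over all signs of z + sum (+- c_j sqrt (t - m_j)) is polynomial in
    z and t: multiplying by the conjugate under w -> - w removes one root at a
    time.  The outer variable of [N] is z, its coefficients are polynomials in t. *)
Lemma conjugate_product (cs : seq (R * R)) :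
  exists N : {poly {poly R}}, forall t z : R,
    (forall p, p \in cs -> p.2 <= t) ->
    N.[z%:P].[t] =
    \prod_(x <- signed_sums [seq p.1 * Num.sqrt (t - p.2) | p <- cs]) (z + x).
Proof.
elim: cs => [|[c m] cs [N IH]].
  by exists 'X => t z _; rewrite !hornerE big_seq1 addr0.
have [ev [od EO]] := even_odd_shift c m N.
exists (ev ^+ 2 - ('X - m%:P)%:P * od ^+ 2) => t z hcs.
have hm : m <= t by exact: (hcs (c, m) (mem_head _ _)).
have hcs' p : p \in cs -> p.2 <= t by move=> pc; apply: hcs; rewrite inE pc orbT.
set w := Num.sqrt (t - m).
have hw : w ^+ 2 = t - m by rewrite sqr_sqrtr // subr_ge0.
have hw' : (- w) ^+ 2 = t - m by rewrite sqrrN.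
rewrite /= big_cat /= !big_map.
have -> : \prod_(j <- signed_sums [seq p.1 * Num.sqrt (t - p.2) | p <- cs])
    (z + (c * w + j)) = N.[(z + c * w)%:P].[t].
  by rewrite IH //; apply: eq_bigr => x _; rewrite addrA.
have -> : \prod_(j <- signed_sums [seq p.1 * Num.sqrt (t - p.2) | p <- cs])
    (z + (- (c * w) + j)) = N.[(z + c * - w)%:P].[t].
  by rewrite IH //; apply: eq_bigr => x _; rewrite addrA mulrN.
rewrite (EO t w z hw) (EO t (- w) z hw') !hornerE -?hw.
transitivity (ev.[z%:P].[t] ^+ 2 - w ^+ 2 * od.[z%:P].[t] * od.[z%:P].[t]); last by ring.
by [].
Qed.

Lemma signed_sums_close (A : Type) (f g : A -> R) (l : seq A) (x : R) :
  x \in signed_sums (map f l) ->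
  exists2 y, y \in signed_sums (map g l) & `|x - y| <= \sum_(a <- l) `|f a - g a|.
Proof.
elim: l x => [|a l IH] x /=.
  by rewrite mem_seq1 => /eqP ->; exists 0; rewrite ?mem_seq1 // big_nil subrr normr0.
rewrite mem_cat => /orP[] /mapP[x' /IH[y yl hy] ->].
  exists (g a + y); first by rewrite mem_cat map_f.
  rewrite big_cons (_ : _ - _ = (f a - g a) + (x' - y)); last by ring.
  by apply: le_trans (ler_normD _ _) _; rewrite lerD2l.
exists (- g a + y); first by rewrite mem_cat map_f // orbT.
rewrite big_cons (_ : _ - _ = (g a - f a) + (x' - y)); last by ring.
by apply: le_trans (ler_normD _ _) _; rewrite distrC lerD2l.
Qed.

Lemma min_abs_nonzero (L : seq R) :
  exists2 e : R, 0 < e & forall y, y \in L -> y != 0 -> e <= `|y|.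
Proof.
elim: L => [|a L [e e0 he]]; first by exists 1.
have [->|a0] := eqVneq a 0.
  by exists e => // y; rewrite inE => /orP[/eqP -> /eqP //|]; exact: he.
exists (Num.min e `|a|); first by rewrite lt_min e0 normr_gt0.
move=> y; rewrite inE ge_min => /orP[/eqP -> _|yL y0]; first by rewrite lexx orbT.
by rewrite he.
Qed.

(** A sum y + c s + O(s^2) with c <> 0 does not vanish for small s > 0: if y <> 0
    then y dominates, and otherwise c s does.  Finitely many values of y are
    treated at once. *)
Lemma small_perturbation (L : seq R) (C c : R) : 0 <= C -> c != 0 ->
  exists2 s : R, 0 < s & forall y x, y \in L -> `|x - y| <= C * s ^+ 2 ->
    x + c * s != 0.
Proof.
move=> C0 c0; have [e e0 he] := min_abs_nonzero L.
have cgt0 : 0 < `|c| by rewrite normr_gt0.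
(* The bounds give s <= 1, C s < |c| and (|c| + C) s < e. *)
pose s := Num.min 1 (Num.min (`|c| / (C + 1)) (e / (2 * (`|c| + C)))).
have den0 : 0 < 2 * (`|c| + C) by rewrite mulr_gt0 // ltr_wpDr.
have C10 : 0 < C + 1 by rewrite ltr_wpDl.
have s0 : 0 < s by rewrite !lt_min ltr01 !divr_gt0.
have s1 : s <= 1 by rewrite ge_min lexx.
have s2 : s * (C + 1) <= `|c|.
  by rewrite -ler_pdivlMr // !ge_min lexx /= orbT.
have s3 : s * (2 * (`|c| + C)) <= e.
  by rewrite -ler_pdivlMr // !ge_min lexx /= !orbT.
exists s => // y x yL hx; apply/negP; rewrite addr_eq0 => /eqP hxs.
have [y0|y0] := eqVneq y 0.
  move: hx; rewrite y0 subr0 hxs normrN normrM (gtr0_norm s0) expr2 mulrA.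
  by rewrite ler_pM2r //; move: s2 s0; lra.
have := he _ yL y0.
have -> : y = - (x - y) - c * s by rewrite hxs; ring.
move=> h; have := le_trans h (ler_normB _ _).
rewrite normrN normrM (gtr0_norm s0).
have : C * s ^+ 2 <= C * s by rewrite ler_wpM2l // expr2 ler_piMl // ltW.
have : 0 < s * (`|c| + C) by rewrite mulr_gt0 // ltr_wpDr.
move: s3 hx; rewrite !mulrDr; lra.
Qed.

Lemma sqrt_increment (m m0 t : R) : m < m0 -> m0 <= t ->
  `|Num.sqrt (t - m) - Num.sqrt (m0 - m)| <= (t - m0) / Num.sqrt (m0 - m).
Proof.
move=> mm0 m0t; set a := Num.sqrt (t - m); set b := Num.sqrt (m0 - m).
have b0 : 0 < b by rewrite sqrtr_gt0 subr_gt0.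
have a2 : a ^+ 2 = t - m by rewrite sqr_sqrtr //; lra.
have b2 : b ^+ 2 = m0 - m by rewrite sqr_sqrtr //; lra.
have ab : b <= a by rewrite ler_wsqrtr //; lra.
rewrite ger0_norm ?subr_ge0 // ler_pdivlMr //.
have -> : t - m0 = a ^+ 2 - b ^+ 2 by rewrite a2 b2; ring.
by rewrite subr_sqr ler_wpM2l ?subr_ge0 // lerDr ltW // (lt_le_trans b0).
Qed.

(** Just to the right of the largest m_j no signed sum vanishes: the root
    s = sqrt (t - m0) of the largest one has infinite slope there, whereas all
    others only move by O(t - m0) = O(s^2). *)
Lemma generic_point (c0 m0 : R) (cs : seq (R * R)) : c0 != 0 ->
  (forall p, p \in cs -> p.2 < m0) ->
  exists2 t : R, m0 <= t &
    0 \notin signed_sums [seq p.1 * Num.sqrt (t - p.2) | p <- (c0, m0) :: cs].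
Proof.
move=> c00 hcs.
pose L := signed_sums [seq p.1 * Num.sqrt (m0 - p.2) | p <- cs].
pose C := \sum_(p <- cs) `|p.1| / Num.sqrt (m0 - p.2).
have C0 : 0 <= C by apply: sumr_ge0 => p _; rewrite divr_ge0 ?sqrtr_ge0.
have [s' s'0 hs'] : exists2 s : R, 0 < s & forall y x, y \in L ->
    `|x - y| <= C * s ^+ 2 -> x + c0 * s != 0 /\ x - c0 * s != 0.
  have [a a0 ha] := small_perturbation (L ++ map -%R L) C0 c00.
  exists a => // y x yL hx; split; first by apply: (ha y); rewrite // mem_cat yL.
  rewrite -oppr_eq0 opprB addrC; apply: (ha (- y)).
    by rewrite mem_cat map_f ?orbT.
  by rewrite -opprD normrN.
exists (m0 + s' ^+ 2); first by rewrite lerDl sqr_ge0.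
set t := m0 + _.
have ts : Num.sqrt (t - m0) = s' by rewrite /t addrC addKr sqrtr_sqr gtr0_norm.
have tm : m0 <= t by rewrite lerDl sqr_ge0.
have close : \sum_(p <- cs)
   `|p.1 * Num.sqrt (t - p.2) - p.1 * Num.sqrt (m0 - p.2)| <= C * s' ^+ 2.
  rewrite /C mulr_suml big_seq [leRHS]big_seq; apply: ler_sum => p pc.
  rewrite -mulrBr normrM -mulrA ler_wpM2l // mulrC.
  by have := sqrt_increment (hcs _ pc) tm; rewrite (_ : t - m0 = s' ^+ 2) // /t; ring.
apply/negP => /=; rewrite mem_cat ts => /orP[] /mapP[x].
  move=> /signed_sums_close-/(_ (fun p => p.1 * Num.sqrt (m0 - p.2))) [y yL hy].
  have [/eqP + _] := hs' _ _ yL (le_trans hy close).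
  by move=> h e; apply: h; rewrite addrC -e.
move=> /signed_sums_close-/(_ (fun p => p.1 * Num.sqrt (m0 - p.2))) [y yL hy].
have [_ /eqP +] := hs' _ _ yL (le_trans hy close).
by move=> h e; apply: h; rewrite addrC -e.
Qed.

Lemma exists_max_snd (cs : seq (R * R)) : cs != [::] ->
  exists2 p, p \in cs & forall q, q \in cs -> q.2 <= p.2.
Proof.
elim: cs => // a cs IH _; have [->|/IH[p pc hp]] := eqVneq cs [::].
  by exists a; rewrite ?mem_head // => q; rewrite mem_seq1 => /eqP ->.
have [ap|pa] := leP a.2 p.2.
  exists p; first by rewrite inE pc orbT.
  by move=> q; rewrite inE => /orP[/eqP ->|/hp].
exists a; first by rewrite mem_head.
move=> q; rewrite inE => /orP[/eqP ->//|/hp qp].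
exact: le_trans qp (ltW pa).
Qed.

(** A relation makes the product of all its conjugates vanish, which is a
    polynomial in t; it is not the zero polynomial because of [generic_point],
    applied to the largest m_j with nonzero coefficient. *)
Lemma finitely_many_root_relations (cs : seq (R * R)) :
  uniq (unzip2 cs) -> (exists2 p, p \in cs & p.1 != 0) ->
  exists2 Q : {poly R}, Q != 0 & forall t : R, (forall p, p \in cs -> p.2 <= t) ->
    \sum_(p <- cs) p.1 * Num.sqrt (t - p.2) = 0 -> root Q t.
Proof.
move=> ucs [p1 p1c p10].
pose cs1 := [seq p <- cs | p.1 != 0].
have p1c1 : p1 \in cs1 by rewrite mem_filter p10.
have [|p0 p0c hp0] := @exists_max_snd cs1.
  by apply/eqP => e; rewrite e in p1c1.
have ucs1 : uniq (unzip2 cs1).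
  by apply: subseq_uniq ucs; apply: map_subseq; apply: filter_subseq.
have prm := perm_to_rem p0c.
pose cs2 := rem p0 cs1.
have c0 : p0.1 != 0 by move: p0c; rewrite mem_filter => /andP[].
have lt2 p : p \in cs2 -> p.2 < p0.2.
  move=> pc; rewrite lt_neqAle hp0 ?(mem_rem pc) // andbT; apply/eqP => e.
  have : uniq (unzip2 (p0 :: cs2)).
    by rewrite -(perm_uniq (perm_map _ prm)).
  by rewrite /= -e map_f.
have [t0 ht0 gen] := generic_point c0 lt2.
have [N hN] := conjugate_product ((p0.1, p0.2) :: cs2).
have hev t : N.[0].[t] = N.[0%:P].[t] by [].
exists N.[0].
  apply/eqP => Q0; have := hN t0 0; rewrite -hev Q0 horner0 => /(_ _)/esym e.
  have : (\prod_(x <- signed_sums [seq p.1 * Num.sqrt (t0 - p.2) |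
      p <- (p0.1, p0.2) :: cs2]) (0 + x) == 0).
    apply/eqP/e => p; rewrite inE => /orP[/eqP -> //|/lt2/ltW pp].
    exact: le_trans pp ht0.
  rewrite prodf_seq_eq0 => /hasP[x xs]; rewrite /= add0r => /eqP x0.
  by move: gen; rewrite -x0 xs.
move=> t ht hsum; rewrite /root hev hN; last first.
  move=> p; rewrite -[(p0.1, p0.2)]surjective_pairing -(perm_mem prm).
  by rewrite mem_filter => /andP[_ /ht].
rewrite prodf_seq_eq0; apply/hasP; exists 0; last by rewrite /= addr0.
have {1}<- : \sum_(w <- [seq p.1 * Num.sqrt (t - p.2) | p <- (p0.1, p0.2) :: cs2]) w = 0.
  rewrite big_map -[(p0.1, p0.2)]surjective_pairing -(perm_big _ prm) /=.
  rewrite big_filter big_mkcond /= -[RHS]hsum; apply: eq_bigr => p _.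
  by case: eqVneq => //= ->; rewrite mul0r.
exact: sum_in_signed_sums.
Qed.

End RootRelations.

(** * Principal curvatures with prescribed Ricci eigenvalues *)
Section Spectra.
Variables (R : rcfType) (n : nat).
Implicit Types d : 'I_n -> R.

Definition trace d : R := \sum_i d i.

(** The eigenvalue of H A - A^2 belonging to the i-th principal curvature. *)
Definition ricci_part d (i : 'I_n) : R := d i * (trace d - d i).

(** Two distinct positions, rather than at most two, are named so that the
    product of the two entries is defined also when fewer are nonzero. *)
Definition rank_le2 d : Prop :=
  exists i1 i2 : 'I_n, i1 != i2 /\ forall i, i != i1 -> i != i2 -> d i = 0.

(** The curvature tensor of a hypersurface with principal curvatures d_i only
    involves the sectional quantities d_i d_j with i <> j. *)
Definition curv_equiv d d' : Prop :=
  exists s : {perm 'I_n}, forall i j, i != j -> d i * d j = d' (s i) * d' (s j).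

Definition spectral_poly d : {poly R} := \prod_i ('X - (d i)%:P).

Lemma curv_equiv_sym d d' : curv_equiv d d' -> curv_equiv d' d.
Proof.
move=> [s hs]; exists (s^-1)%g => i j ij.
by rewrite hs ?permKV // (inj_eq perm_inj).
Qed.

Lemma curv_equiv_trans d d' d'' : curv_equiv d d' -> curv_equiv d' d'' -> curv_equiv d d''.
Proof.
move=> [s hs] [s' hs']; exists (s * s')%g => i j ij.
by rewrite hs // hs' ?(inj_eq perm_inj) // !permM.
Qed.

Lemma perm_curv_equiv d d' (s : {perm 'I_n}) : (forall i, d i = d' (s i)) -> curv_equiv d d'.
Proof. by move=> h; exists s => i j _; rewrite !h. Qed.

Lemma perm_eq_codom d d' : perm_eq (codom d) (codom d') ->
  exists s : {perm 'I_n}, forall i, d i = d' (s i).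
Proof.
have cd e : codom e = [tuple e i | i < n] by rewrite /= codomE.
rewrite !cd => /tuple_permP[s hs].
have {}hs : [tuple d i | i < n] = [tuple tnth [tuple d' i | i < n] (s i) | i < n].
  exact: val_inj.
by exists s => i; have := congr1 (fun u => tnth u i) hs; rewrite !tnth_mktuple.
Qed.

Lemma spectral_poly_inj d d' : spectral_poly d = spectral_poly d' ->
  exists s : {perm 'I_n}, forall i, d i = d' (s i).
Proof.
move=> h; apply: perm_eq_codom; apply: prod_XsubC_eq; move: h.
by rewrite /spectral_poly !codomE !big_map.
Qed.

Lemma rank_le2_perm d (s : {perm 'I_n}) : rank_le2 (fun i => d (s i)) -> rank_le2 d.
Proof.
move=> [i1 [i2 [ne h]]]; exists (s i1), (s i2); rewrite (inj_eq perm_inj).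
split=> // i h1 h2; rewrite -(permKV s i) h //.
  by apply: contra_neq h1 => <-; rewrite permKV.
by apply: contra_neq h2 => <-; rewrite permKV.
Qed.

Lemma trace_perm d (s : {perm 'I_n}) : trace (fun i => d (s i)) = trace d.
Proof. by rewrite /trace [RHS](reindex_perm s). Qed.

Lemma sum_ricci_part d :
  \sum_i ricci_part d i = trace d ^+ 2 - \sum_i d i ^+ 2.
Proof.
rewrite /ricci_part (eq_bigr (fun i => trace d * d i - d i ^+ 2)); last first.
  by move=> i _; ring.
by rewrite sumrB -mulr_sumr -expr2.
Qed.

Lemma big_two (i1 i2 : 'I_n) (F : 'I_n -> R) : i1 != i2 ->
  (forall i, i != i1 -> i != i2 -> F i = 0) -> \sum_i F i = F i1 + F i2.
Proof.
move=> ne h; rewrite (bigD1 i1) //= (bigD1 i2) 1?eq_sym //= big1 ?addr0 //.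
by move=> i /andP[]; exact: h.
Qed.

(** The sum of the mu_i is H^2 - sum d_i^2, which is 2 d_1 d_2 here. *)
Lemma rank_le2_product d (i1 i2 : 'I_n) : i1 != i2 ->
  (forall i, i != i1 -> i != i2 -> d i = 0) ->
  d i1 * d i2 = 2^-1 * \sum_i ricci_part d i.
Proof.
move=> ne h; rewrite sum_ricci_part /trace (big_two ne h).
rewrite (@big_two i1 i2) //; last by move=> i h1 h2; rewrite h // expr0n.
by field.
Qed.

Lemma perm_two (i1 i2 j1 j2 : 'I_n) : i1 != i2 -> j1 != j2 ->
  exists s : {perm 'I_n}, s i1 = j1 /\ s i2 = j2.
Proof.
move=> ni nj; exists (tperm i1 j1 * tperm (tperm i1 j1 i2) j2)%g.
rewrite !permM tpermL; split; last by rewrite tpermL.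
apply: tpermD; last by rewrite eq_sym.
by rewrite -[X in _ != X](tpermL i1 j1) (inj_eq perm_inj) eq_sym.
Qed.

Lemma rank_le2_curv_equiv d d' : rank_le2 d -> rank_le2 d' ->
  \sum_i ricci_part d i = \sum_i ricci_part d' i -> curv_equiv d d'.
Proof.
move=> [i1 [i2 [ni hi]]] [j1 [j2 [nj hj]]] e.
have [s [s1 s2]] := perm_two ni nj; exists s => i j ij.
have p : d i1 * d i2 = d' j1 * d' j2.
  by rewrite (rank_le2_product ni hi) (rank_le2_product nj hj) e.
have sn k : k != i1 -> k != i2 -> d k = 0 /\ d' (s k) = 0.
  move=> k1 k2; rewrite hi // hj //; [rewrite -s1|rewrite -s2];
  by rewrite (inj_eq perm_inj).
have [i1e|i1n] := eqVneq i i1; have [i2e|i2n] := eqVneq i i2;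
  have [j1e|j1n] := eqVneq j i1; have [j2e|j2n] := eqVneq j i2; subst;
  rewrite ?eqxx // in ni ij *; rewrite ?s1 ?s2 //.
all: try by rewrite mulrC p mulrC.
all: try by have [-> ->] := sn _ j1n j2n; rewrite !mulr0.
all: by have [-> ->] := sn _ i1n i2n; rewrite !mul0r.
Qed.

(** With [spectral_poly_rank_le2], this makes [rank_le2] a condition on the
    coefficients of the spectral polynomial, hence a closed condition. *)
Lemma rank_le2_spectral_poly d : rank_le2 d ->
  spectral_poly d = 'X^(n - 2) *
    ('X^2 - trace d *: 'X + (2^-1 * \sum_i ricci_part d i)%:P).
Proof.
move=> [i1 [i2 [ne h]]].
rewrite -(rank_le2_product ne h) /trace (big_two ne h).
rewrite /spectral_poly (bigD1 i1) //= (bigD1 i2) 1?eq_sym //=.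
rewrite (eq_bigr (fun=> 'X)); last first.
  by move=> i /andP[i1n i2n]; rewrite h // subr0.
rewrite prodr_const.
have -> : #|[pred i | (i != i1) && (i != i2)]| = (n - 2)%N.
  have := cardsC [set i1; i2]; rewrite cards2 ne card_ord => /= e.
  rewrite -[in RHS]e addKn; apply: eq_card => i; by rewrite !inE negb_or.
rewrite -mul_polyC polyCD polyCM; ring.
Qed.

Lemma small_set_sub2 (A : {set 'I_n}) : (2 <= n)%N -> (#|A| <= 2)%N ->
  exists i1 i2 : 'I_n, i1 != i2 /\ forall i, i != i1 -> i != i2 -> i \notin A.
Proof.
move=> n2; pose o0 := Ordinal (ltnW n2 : 0 < n)%N; pose o1 := Ordinal n2.
have other (a : 'I_n) : exists b : 'I_n, a != b.
  by have [->|a0] := eqVneq a o0; [exists o1|exists o0].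
rewrite leq_eqVlt => /orP[/cards2P[a [b [ne ->]]]|].
  by exists a, b; split=> // i ia ib; rewrite !inE negb_or ia.
rewrite ltnS leq_eqVlt => /orP[/cards1P[a ->]|].
  have [b ab] := other a; exists a, b; split=> // i ia ib; by rewrite inE.
rewrite ltnS leqn0 cards_eq0 => /eqP ->; exists o0, o1; split=> // i _ _.
by rewrite inE.
Qed.

Lemma many_zeros_rank_le2 d : (2 <= n)%N -> (n - 2 <= #|[set i | d i == 0%R]|)%N ->
  rank_le2 d.
Proof.
set Z := [set i | _] => n2 hz.
have [|i1 [i2 [ne h]]] := @small_set_sub2 (~: Z) n2.
  have := cardsC Z; rewrite card_ord => e.
  by rewrite -(leq_add2l #|Z|) e; lia.
exists i1, i2; split=> // i h1 h2; have := h i h1 h2.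
by rewrite !inE negbK => /eqP.
Qed.

Lemma spectral_poly_rank_le2 d q : (2 <= n)%N ->
  spectral_poly d = 'X^(n - 2) * q -> rank_le2 d.
Proof.
move=> n2 e; apply: many_zeros_rank_le2 => //.
have p0 : spectral_poly d != 0 by rewrite monic_neq0 // monic_prod_XsubC.
have -> : #|[set i | d i == 0]| = mup 0 (spectral_poly d).
  have -> : spectral_poly d = \prod_(y <- codom d) ('X - y%:P).
    by rewrite /spectral_poly codomE big_map big_enum.
  rewrite mu_prod_XsubC codomE count_map -size_filter cardE.
  congr size; rewrite [in RHS]enumT; apply: eq_filter => i; by rewrite !inE.
by rewrite mup_geq // subr0 e dvdp_mulr.
Qed.

Lemma exists_root_list (p : {poly R}) : p != 0 ->
  exists T : seq R, forall x, root p x -> x \in T.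
Proof.
by move=> p0; exists (rootsR p) => x rx; rewrite -(roots_on_rootsR p0) rx.
Qed.

Lemma finite_union_list (K : finType) (P : K -> R -> Prop) :
  (forall k, exists T : seq R, forall x, P k x -> x \in T) ->
  exists T : seq R, forall k x, P k x -> x \in T.
Proof.
move=> /choice[L hL]; exists (flatten [seq L k | k <- enum K]) => k x Pkx.
apply/flattenP; exists (L k); last exact: hL.
by apply: map_f; rewrite mem_enum.
Qed.

Definition sgb (b : bool) : R := if b then -1 else 1.

Lemma sgb_sqr (b : bool) : sgb b * sgb b = 1.
Proof. by case: b; rewrite /sgb ?mulrNN mulr1. Qed.

Lemma sgb_sqrt (y v : R) : y ^+ 2 = v -> y = sgb (y < 0) * Num.sqrt v.
Proof.
move=> <-; rewrite sqrtr_sqr /sgb; case: ltP => h.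
  by rewrite ltr0_norm // mulrNN mul1r.
by rewrite mul1r ger0_norm.
Qed.

Lemma sum_seq_pred1 (W : seq R) (a : R) (F : R -> R) : uniq W -> a \in W ->
  \sum_(v <- W | v == a) F v = F a.
Proof. by move=> uW aW; rewrite -big_filter filter_pred1_uniq // big_seq1. Qed.

(** The roots 2 d_i - H of H^2 - 4 mu_i add up to - (n - 2) H.  For a fixed
    choice of signs, collecting equal radicands gives a relation with integer
    coefficients [c e v] between the square roots of t - v at t = H^2.  The
    coefficient at v = 0 is nonzero: otherwise at least n - 2 of the indices with
    mu_i = 0 carry the sign opposite to that of H, that is, 2 d_i - H = - H and
    d_i = 0. *)
Lemma finitely_many_traces (mu : 'I_n -> R) : (2 <= n)%N ->
  exists T : seq R, forall d, (forall i, ricci_part d i = mu i) -> ~ rank_le2 d ->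
    trace d ^+ 2 \in T.
Proof.
move=> n2.
pose W := undup (0 :: [seq 4 * mu i | i <- enum 'I_n]).
have uW : uniq W by exact: undup_uniq.
have W0 : 0 \in W by rewrite mem_undup mem_head.
have Wmu i : 4 * mu i \in W.
  rewrite mem_undup inE; apply/orP; right.
  by apply/mapP; exists i; rewrite ?mem_enum.
pose c (e : {ffun 'I_n -> bool} * bool) v : R :=
  \sum_(i | 4 * mu i == v) sgb (e.1 i) + (v == 0)%:R * ((n - 2)%:R * sgb e.2).
pose cs e := [seq (c e v, v) | v <- W].
(* The radicand 0 belongs to H itself, whence its extra coefficient n - 2. *)
pose P e t := c e 0 != 0 /\ (forall p, p \in cs e -> p.2 <= t) /\
  \sum_(p <- cs e) p.1 * Num.sqrt (t - p.2) = 0.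
have [|T hT] := @finite_union_list _ P.
  move=> e; have [c0|c0] := eqVneq (c e 0) 0.
    by exists [::] => t [/eqP].
  have [||Q Q0 hQ] := @finitely_many_root_relations _ (cs e).
  - by rewrite /unzip2 -map_comp map_id_in.
  - by exists (c e 0, 0) => //; apply: map_f.
  have [T hT] := exists_root_list Q0; exists T => t [_ [h1 h2]].
  by apply: hT; exact: hQ.
exists T => d hd nsp.
pose H := trace d; pose y i := 2 * d i - H.
have y2 i : y i ^+ 2 = H ^+ 2 - 4 * mu i.
  by rewrite -hd /ricci_part -/H /y; ring.
pose e := ([ffun i => y i < 0], H < 0).
apply: (hT e); split; [|split].
- apply/eqP => c0; apply: nsp; apply: many_zeros_rank_le2 => //.
  pose Z := [set i | (4 * mu i == 0) && (e.1 i != e.2)].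
  have sZ : Z \subset [set i | d i == 0].
    apply/fintype.subsetP => i; rewrite !inE ffunE /= => /andP[/eqP m0 ne].
    have := y2 i; rewrite m0 subr0 => /sgb_sqrt yi.
    have := sgb_sqrt (erefl (H ^+ 2)); move: yi ne; rewrite -/H.
    move: (Num.sqrt _) => r; rewrite /sgb.
    case: (y i < 0); case: (H < 0) => //= + _; rewrite /y => yi hH; apply/eqP; lra.
  apply: leq_trans (subset_leq_card sZ).
  move: c0; rewrite /c eqxx mul1r => c0.
  have {}c0 : \sum_(i | 4 * mu i == 0) (sgb e.2 * sgb (e.1 i)) = - (n - 2)%:R.
    have -> : \sum_(i | 4 * mu i == 0) sgb e.2 * sgb (e.1 i) =
        sgb e.2 * - ((n - 2)%:R * sgb e.2).
      by rewrite -mulr_sumr; congr (_ * _); apply/eqP; rewrite -addr_eq0 c0.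
    by rewrite mulrN mulrCA sgb_sqr mulr1.
  have : - (\sum_(i | 4 * mu i == 0) (e.1 i != e.2)%:R) <=
      \sum_(i | 4 * mu i == 0) (sgb e.2 * sgb (e.1 i)).
    rewrite -sumrN; apply: ler_sum => i _.
    by case: (e.1 i); case: e.2; rewrite /sgb /=; lra.
  rewrite c0 lerN2 -natr_sum ler_nat; congr (_ <= _)%N.
  rewrite -big_mkcondr sum1_card.
  by apply: eq_card => i; rewrite !inE.
- move=> p /mapP[v vW ->] /=; move: vW; rewrite mem_undup inE.
  move=> /orP[/eqP ->|/mapP[i _ ->]]; first exact: sqr_ge0.
  by rewrite -subr_ge0 -y2 sqr_ge0.
- rewrite big_map /= -/H.
  transitivity (\sum_i y i + (n - 2)%:R * H); last first.
    rewrite /y big_split /= -mulr_sumr -/(trace d) -/H sumrN sumr_const card_ord.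
    by rewrite -mulr_natl natrB //; ring.
  under eq_bigr => v _ do rewrite mulrDl mulr_suml big_mkcond /=.
  rewrite big_split /= exchange_big /=; congr (_ + _).
    apply: eq_bigr => i _; rewrite -big_mkcond /=.
    under eq_bigl => v do rewrite eq_sym.
    by rewrite sum_seq_pred1 // ffunE -y2 -sgb_sqrt.
  transitivity (\sum_(v <- W | v == 0) (n - 2)%:R * sgb (H < 0) * Num.sqrt (H ^+ 2 - v)).
    rewrite [RHS]big_mkcond; apply: eq_bigr => v _.
    by case: eqP; rewrite ?mul1r // !mul0r.
  by rewrite sum_seq_pred1 // subr0 -mulrA -sgb_sqrt.
Qed.

Lemma finitely_many_spectral_polys (mu : 'I_n -> R) : (2 <= n)%N ->
  exists L : seq {poly R}, forall d, (forall i, ricci_part d i = mu i) ->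
    ~ rank_le2 d -> spectral_poly d \in L.
Proof.
move=> n2; have [T hT] := finitely_many_traces mu n2.
pose D := [seq (sgb p.1 * Num.sqrt q.1 + sgb p.2 * Num.sqrt (q.1 - 4 * mu q.2)) / 2
  | p <- enum {: bool * bool}, q <- [seq (t, i) | t <- T, i <- enum 'I_n]].
pose L := [seq \prod_i ('X - (nth 0 D (k i))%:P) |
  k : {ffun 'I_n -> 'I_(size D)} <- enum {: {ffun 'I_n -> 'I_(size D)}}].
exists L => d hd nsp.
pose H := trace d; pose y i := 2 * d i - H.
have y2 i : y i ^+ 2 = H ^+ 2 - 4 * mu i.
  by rewrite -hd /ricci_part -/H /y; ring.
have dD i : d i \in D.
  apply/allpairsP; exists ((H < 0, y i < 0), (H ^+ 2, i)); split => /=.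
  - by rewrite mem_enum.
  - by apply: allpairs_f; rewrite ?mem_enum //; exact: hT.
  - by rewrite -(sgb_sqrt (y2 i)) -(sgb_sqrt (erefl (H ^+ 2))) /y; field.
have sD i : (index (d i) D < size D)%N by rewrite index_mem.
apply/mapP; exists [ffun i => Ordinal (sD i)]; first by rewrite mem_enum.
by apply: eq_bigr => i _; rewrite ffunE /= nth_index.
Qed.

End Spectra.

(** * Isolation of the curvature types *)
Section Separation.
Variables (R : rcfType) (n : nat).
Implicit Types d : 'I_n -> R.

Lemma spectral_poly_perm d (s : {perm 'I_n}) : spectral_poly (fun i => d (s i)) = spectral_poly d.
Proof. by rewrite /spectral_poly [RHS](reindex_perm s). Qed.

Lemma ricci_part_perm d (s : {perm 'I_n}) i : ricci_part (fun i => d (s i)) i = ricci_part d (s i).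
Proof. by rewrite /ricci_part trace_perm. Qed.

Lemma horner_eq_poly (p q : {poly R}) : (forall t, p.[t] = q.[t]) -> p = q.
Proof.
move=> h; apply/eqP; rewrite -subr_eq0; apply/negPn/negP => ne.
have [T hT] := exists_root_list ne.
have [t tT] : exists t : R, t \notin T.
  pose m := \sum_(x <- T) `|x| + 1; exists m; apply/negP => mT.
  have : `|m| <= \sum_(x <- T) `|x|.
    rewrite (big_rem m mT) /= lerDl; exact: sumr_ge0.
  by rewrite ger0_norm ?addr_ge0 ?sumr_ge0 // /m => h1; lra.
by move/negP: tT; apply; apply: hT; rewrite rootE !hornerE h subrr.
Qed.

Lemma separate_polys (L : seq {poly R}) (p : {poly R}) :
  exists (T : seq R) (e : R), 0 < e /\
    forall q, q \in L -> (forall t, t \in T -> `|q.[t] - p.[t]| < e) -> q = p.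
Proof.
elim: L => [|q L [T [e [e0 h]]]]; first by exists [::], 1.
have [->|qp] := eqVneq q p.
  by exists T, e; split=> // q'; rewrite inE => /orP[/eqP ->|/h].
have [t qt] : exists t, q.[t] != p.[t].
  apply: contrapT => hn; move/eqP: qp; apply; apply: horner_eq_poly => t.
  by apply/eqP/negPn/negP => ht; apply: hn; exists t.
exists (t :: T), (Num.min e `|q.[t] - p.[t]|).
split; first by rewrite lt_min e0 normr_gt0 subr_eq0.
move=> q'; rewrite inE => /orP[/eqP -> hc|q'L hc].
  by have := hc t (mem_head _ _); rewrite lt_min ltxx andbF.
apply: h => // t' t'T; have := hc t'; rewrite inE t'T orbT => /(_ isT).
by rewrite lt_min => /andP[].
Qed.

(** If all but two entries of d vanish, its spectral polynomial is
    X^(n-2) (X^2 - h X + e2) with e2 prescribed; evaluation at 1 yields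
    h = 1 + e2 - p(1).  The defect compares p(t) with this formula and depends
    affinely on p(t) and p(1). *)
Definition rank_le2_defect (e2 : R) (p : {poly R}) (t : R) : R :=
  p.[t] - t ^+ (n - 2) * (t ^+ 2 - (1 + e2 - p.[1]) * t + e2).

Lemma rank_le2_defect0 d : rank_le2 d ->
  forall t, rank_le2_defect (2^-1 * \sum_i ricci_part d i) (spectral_poly d) t = 0.
Proof.
move=> /rank_le2_spectral_poly e t; rewrite /rank_le2_defect e !hornerE !expr1n; ring.
Qed.

Lemma rank_gt2_defect d (e2 : R) : (2 <= n)%N -> ~ rank_le2 d ->
  exists t, rank_le2_defect e2 (spectral_poly d) t != 0.
Proof.
move=> n2 nsp; apply: contrapT => hn; apply: nsp.
pose h := 1 + e2 - (spectral_poly d).[1].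
apply: (@spectral_poly_rank_le2 _ _ d ('X^2 - h *: 'X + e2%:P) n2).
apply: horner_eq_poly => t; rewrite !hornerE.
apply/eqP; rewrite -subr_eq0; apply/negPn/negP => ht.
by apply: hn; exists t.
Qed.

(** Among the spectra with the same mu_i, those with more than two nonzero entries
    have finitely many spectral polynomials and can be separated from d.  Those
    with at most two satisfy a closed condition: either d satisfies it too, and
    then all of them have the type of d, or they stay away from d. *)
Lemma locally_unique_type d : (2 <= n)%N ->
  exists (T : seq R) (e : R), 0 < e /\
    forall d' (s : {perm 'I_n}), (forall i, ricci_part d i = ricci_part d' (s i)) ->
      (forall t, t \in T -> `|(spectral_poly d').[t] - (spectral_poly d).[t]| < e) ->
      curv_equiv d d'.
Proof.
move=> n2; have [L hL] := finitely_many_spectral_polys (ricci_part d) n2.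
have [T [e [e0 hT]]] := separate_polys L (spectral_poly d).
have rank_gt2_case d' (s : {perm 'I_n}) : (forall i, ricci_part d i = ricci_part d' (s i)) ->
    ~ rank_le2 d' ->
    (forall t, t \in T -> `|(spectral_poly d').[t] - (spectral_poly d).[t]| < e) ->
    exists s' : {perm 'I_n}, forall i, d i = d' (s' i).
  move=> hs nsp hc; apply: spectral_poly_inj; apply: esym; apply: hT => //.
  rewrite -(spectral_poly_perm d' s); apply: hL.
    by move=> i; rewrite ricci_part_perm hs.
  by move=> /rank_le2_perm.
have [sp|nsp] := pselect (rank_le2 d).
  exists T, e; split=> // d' s hs hc; apply: rank_le2_curv_equiv => //.
    have [//|nsp'] := pselect (rank_le2 d'); have [s' hs'] := rank_gt2_case _ _ hs nsp' hc.
    apply: (@rank_le2_perm _ _ d' s'); move: sp; congr rank_le2; exact/funext.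
  by rewrite [RHS](reindex_perm s); apply: eq_bigr => i _; exact: hs.
pose e2 := 2^-1 * \sum_i ricci_part d i.
have [t ht] := rank_gt2_defect e2 n2 nsp.
set a := rank_le2_defect _ _ _ in ht.
(* A change of p(t) and p(1) by less than e changes the defect by less than e b. *)
pose b := 1 + `|t ^+ (n - 2) * t|.
have b0 : 0 < b by rewrite ltr_pwDl.
have a0 : 0 < `|a| by rewrite normr_gt0.
exists [:: t, 1 & T], (Num.min e (`|a| / b)); split.
  by rewrite lt_min e0 divr_gt0.
move=> d' s hs hc; have [sp'|nsp'] := pselect (rank_le2 d'); last first.
  have [t' t'T|s' hs'] := rank_gt2_case _ _ hs nsp'.
    have := hc t'; rewrite !inE t'T !orbT lt_min => /(_ isT).
    by case/andP.
  exact: perm_curv_equiv hs'.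
have mus : \sum_i ricci_part d i = \sum_i ricci_part d' i.
  by rewrite [RHS](reindex_perm s); apply: eq_bigr => i _; exact: hs.
have z := rank_le2_defect0 sp' t; rewrite -mus -/e2 in z.
have h1 := hc t (mem_head _ _); have h2 := hc 1; rewrite !inE eqxx orbT in h2.
have {}h2 := h2 isT; move: h1 h2; rewrite !lt_min => /andP[_ h1] /andP[_ h2].
set u := (spectral_poly d').[t] - _ in h1; set v := (spectral_poly d').[1] - _ in h2.
have ea : - a = u - t ^+ (n - 2) * t * v.
  by rewrite -[LHS]add0r -z /rank_le2_defect /a /rank_le2_defect /u /v; ring.
have : `|a| < `|a| / b * b.
  have -> : `|a| / b * b = `|a| / b + `|t ^+ (n - 2) * t| * (`|a| / b).
    by rewrite -[in LHS]mulrC mulrDl mul1r.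
  rewrite -[X in X < _]normrN ea; apply: le_lt_trans (ler_normB _ _) _.
  by rewrite normrM ltr_leD // ler_wpM2l // ltW.
by rewrite divfK ?gt_eqF // ltxx.
Qed.

End Separation.

(** * Simultaneous diagonalization *)
Section RealImaginaryParts.
Variable R : rcfType.

Lemma Re_mulmx_real m n p (W : 'M[R[i]%C]_(m, n)) (S : 'M[R]_(n, p)) :
  map_mx (@complex.Re R) (W *m map_mx (real_complex R) S) = map_mx (@complex.Re R) W *m S.
Proof.
apply/matrixP => i j; rewrite !mxE.
rewrite (big_morph (@complex.Re R) (id1 := 0) (op1 := +%R)) //; last by case=> ? ? [].
apply: eq_bigr => k _; rewrite !mxE; case: (W i k) => a b /=.
by rewrite mulr0 subr0.
Qed.

Lemma Im_mulmx_real m n p (W : 'M[R[i]%C]_(m, n)) (S : 'M[R]_(n, p)) :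
  map_mx (@complex.Im R) (W *m map_mx (real_complex R) S) = map_mx (@complex.Im R) W *m S.
Proof.
apply/matrixP => i j; rewrite !mxE.
rewrite (big_morph (@complex.Im R) (id1 := 0) (op1 := +%R)) //; last by case=> ? ? [].
apply: eq_bigr => k _; rewrite !mxE; case: (W i k) => a b /=.
by rewrite mulr0 add0r.
Qed.

End RealImaginaryParts.

Section SimultaneousDiagonalization.
Variable R : realType.

Definition posdef n (G : 'M[R]_n) := forall v : 'rV[R]_n, v != 0 -> 0 < bform G v v.

Lemma bform_sym n (S : 'M[R]_n) (u v : 'rV[R]_n) : S^T = S -> bform S u v = bform S v u.
Proof.
move=> sS; rewrite /bform -[LHS](_ : (u *m S *m v^T)^T 0 0 = _); last by rewrite mxE.
by rewrite !trmx_mul trmxK sS mulmxA.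
Qed.

Lemma bformDl n (S : 'M[R]_n) (u u' v : 'rV[R]_n) :
  bform S (u + u') v = bform S u v + bform S u' v.
Proof. by rewrite /bform !mulmxDl mxE. Qed.

Lemma bformZl n (S : 'M[R]_n) a (u v : 'rV[R]_n) : bform S (a *: u) v = a * bform S u v.
Proof. by rewrite /bform -!scalemxAl mxE. Qed.

Lemma bformZr n (S : 'M[R]_n) a (u v : 'rV[R]_n) : bform S u (a *: v) = a * bform S u v.
Proof. by rewrite /bform linearZ -scalemxAr mxE. Qed.

Lemma posdef_ge0 n (G : 'M[R]_n) v : posdef G -> 0 <= bform G v v.
Proof.
move=> pG; have [->|/pG/ltW //] := eqVneq v 0.
by rewrite /bform !mul0mx mxE.
Qed.

Lemma posdef_unit n (G : 'M[R]_n) : posdef G -> G \in unitmx.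
Proof.
move=> pG; rewrite -row_free_unit -kermx_eq0; apply: contraT => /rowV0Pn[v].
move=> /sub_kermxP vG /pG; by rewrite /bform vG mul0mx mxE ltxx.
Qed.

(** A complex eigenvector u + i v for the eigenvalue a + i b satisfies
    b (G(u, u) + G(v, v)) = 0 by symmetry of S, so the eigenvalue is real and
    u or v is a real eigenvector. *)
Lemma relative_eigenvector n (G S : 'M[R]_n.+1) : G^T = G -> S^T = S -> posdef G ->
  exists (a : R) (v : 'rV[R]_n.+1), v != 0 /\ v *m S = a *: (v *m G).
Proof.
move=> sG sS pG; have uG := posdef_unit pG.
pose toC := @map_mx _ _ (real_complex R).
have [z /eigenvalueP[w hw w0]] :=
  @eigenvalue_closed (R[i]%C) n.+1 (toC _ _ (S *m invmx G)) isT.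
have {}hw : w *m toC _ _ S = z *: (w *m toC _ _ G).
  by rewrite scalemxAl -hw -mulmxA -map_mxM /= mulmxKV.
pose u := map_mx (@complex.Re R) w; pose v := map_mx (@complex.Im R) w.
case: z hw => a b hw.
have hu : u *m S = a *: (u *m G) - b *: (v *m G).
  rewrite -!Re_mulmx_real -!Im_mulmx_real -/(toC _ _ S) hw.
  by apply/rowP => j; rewrite !mxE; case: (\sum_(_ < _) _).
have hv : v *m S = a *: (v *m G) + b *: (u *m G).
  rewrite -!Re_mulmx_real -!Im_mulmx_real -/(toC _ _ S) hw.
  by apply/rowP => j; rewrite !mxE; case: (\sum_(_ < _) _).
have b0 : b * (bform G u u + bform G v v) = 0.
  have : bform S u v = a * bform G u v - b * bform G v v.
    by rewrite /bform hu mulmxBl -!scalemxAl !mxE.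
  have : bform S v u = a * bform G v u + b * bform G u u.
    by rewrite /bform hv mulmxDl -!scalemxAl !mxE.
  by rewrite (bform_sym v u sS) (bform_sym v u sG); lra.
have uv0 : (u != 0) || (v != 0).
  apply: contraR w0; rewrite negb_or !negbK => /andP[/eqP u0 /eqP v0].
  apply/eqP/rowP => j; have /rowP/(_ j) := u0; have /rowP/(_ j) := v0.
  by rewrite !mxE; case: (w 0 j) => x y /= -> ->.
have {}b0 : b = 0.
  have : 0 < bform G u u + bform G v v.
    case/orP: uv0 => [/pG h|/pG h]; have := posdef_ge0 u pG; have := posdef_ge0 v pG; lra.
  by move: b0 => /eqP; rewrite mulf_eq0 => /orP[/eqP //|/eqP ->]; rewrite ltxx.
case/orP: uv0 => h; [exists a, u|exists a, v]; split=> //.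
  by rewrite hu b0 scale0r subr0.
by rewrite hv b0 scale0r addr0.
Qed.

Lemma row_free_basis (F : fieldType) m n k (A : 'M[F]_(m, n)) : \rank A = k ->
  exists C : 'M[F]_(k, n), row_free C /\ (C <= A)%MS.
Proof.
by move=> <-; exists (row_base A); rewrite row_base_free eq_row_base.
Qed.

(** Induction on the dimension.  The forms S and G both split off a common
    eigenvector; as G is arbitrary, any basis of the complement will do. *)
Lemma simultaneous_diagonalization n (G S : 'M[R]_n) :
  G^T = G -> S^T = S -> posdef G ->
  exists (P : 'M[R]_n) (d : 'rV[R]_n),
    P *m G *m P^T = 1%:M /\ P *m S *m P^T = diag_mx d.
Proof.
elim: n G S => [|n IH] G S sG sS pG.
  by exists 0, 0; split; apply/matrixP => -[].
have [a [v0 [v0n hv0]]] := relative_eigenvector sG sS pG.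
pose v := (Num.sqrt (bform G v0 v0))^-1 *: v0.
have q0 := pG _ v0n.
have vG : v *m G *m v^T = 1%:M.
  rewrite [LHS]mx11_scalar; congr (_%:M).
  rewrite -/(bform G v v) bformZl bformZr mulrA -expr2 exprVn sqr_sqrtr ?ltW //.
  by rewrite mulVf // gt_eqF.
have hv : v *m S = a *: (v *m G).
  by rewrite -!scalemxAl hv0 scalerA mulrC -scalerA.
have vn0 : v != 0.
  apply/eqP => e; move: vG; rewrite e !mul0mx => /matrixP/(_ 0 0)/eqP.
  by rewrite !mxE eqxx eq_sym oner_eq0.
(* The G-orthogonal complement of v is the kernel of w. *)
pose w := G *m v^T.
have rw : \rank w = 1%N.
  apply/eqP; rewrite eqn_leq rank_leq_col lt0n mxrank_eq0; apply/eqP => e.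
  move: vG; rewrite -mulmxA -/w e mulmx0 => /matrixP/(_ 0 0)/eqP.
  by rewrite !mxE eqxx eq_sym oner_eq0.
have rK : \rank (kermx w) = n by rewrite mxrank_ker rw subn1.
have [C [Cfree CK]] := row_free_basis rK.
have Cw : C *m (G *m v^T) = 0 by apply/sub_kermxP.
have sG' : (C *m G *m C^T)^T = C *m G *m C^T by rewrite !trmx_mul trmxK sG mulmxA.
have sS' : (C *m S *m C^T)^T = C *m S *m C^T by rewrite !trmx_mul trmxK sS mulmxA.
have pG' : posdef (C *m G *m C^T).
  move=> u u0; have := pG (u *m C); rewrite /bform trmx_mul !mulmxA; apply.
  by rewrite -(inj_eq (row_free_inj Cfree)) in u0; rewrite mul0mx in u0.
have [P [d [hP hd]]] := IH _ _ sG' sS' pG'.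
have vGC : v *m G *m C^T = 0.
  by apply: trmx_inj; rewrite !trmx_mul trmxK sG trmx0.
have vSC : v *m S *m C^T = 0 by rewrite hv -scalemxAl vGC scaler0.
have CSv : C *m S *m v^T = 0.
  by apply: trmx_inj; rewrite !trmx_mul trmxK sS mulmxA vSC trmx0.
have CGv : C *m G *m v^T = 0 by rewrite -mulmxA.
exists (col_mx v (P *m C) : 'M[R]_(1 + n)), (row_mx a%:M d : 'rV[R]_(1 + n)).
have expand (B : 'M[R]_(1 + n)) :
    (col_mx v (P *m C) : 'M[R]_(1 + n)) *m B *m
    (col_mx v (P *m C))^T = block_mx (v *m B *m v^T) (v *m B *m C^T *m P^T)
      (P *m (C *m B *m v^T)) (P *m (C *m B *m C^T) *m P^T).
  rewrite tr_col_mx mul_col_mx mul_mx_row !mul_col_mx trmx_mul !mulmxA.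
  by rewrite [RHS]block_mxEh.
rewrite !expand; split.
  by rewrite vG vGC CGv hP mul0mx mulmx0 -scalar_mx_block.
rewrite vSC CSv hd mul0mx mulmx0.
have e := diag_mx_row (a%:M : 'rV[R]_1) d.
refine (etrans _ (esym e)); congr block_mx.
rewrite hv -scalemxAl vG; apply/matrixP => i j; rewrite !ord1 !mxE eqxx.
by rewrite /= mulr1n mulr1 mulr1n.
Qed.

End SimultaneousDiagonalization.

(** * Differential calculus in normed spaces *)
Lemma continuous_on_eq (T S : topologicalType) (U : set T) (x : T) (f g : T -> S) :
  open U -> U x -> (forall y, U y -> f y = g y) ->
  {for x, continuous f}%classic -> {for x, continuous g}%classic.
Proof.
move=> oU Ux fg cf.
have : (f y @[y --> x] --> g x)%classic by rewrite -fg.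
apply: cvg_trans; apply: near_eq_cvg.
by have := open_nbhs_nbhs (conj oU Ux); apply: filterS => y Uy; rewrite fg.
Qed.

Section DerivativeRules.
Local Open Scope classical_set_scope.
Variables (R : realType) (V : normedModType R).
Implicit Types (f g : V -> R) (x v : V).

Lemma is_derive_mulf f g x v df dg : is_derive x v f df -> is_derive x v g dg ->
  is_derive x v (fun y => f y * g y) (df * g x + f x * dg).
Proof.
move=> hf hg; have := is_deriveM hf hg.
by rewrite addrC /= [g x *: df]mulrC.
Qed.

Lemma is_derive_sumf n (h : 'I_n -> V -> R) x v (dh : 'I_n -> R) :
  (forall i, is_derive x v (h i) (dh i)) ->
  is_derive x v (fun y => \sum_i h i y) (\sum_i dh i).
Proof.
move=> /is_derive_sum; congr (is_derive _ _ _ _).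
by apply/funext => y; rewrite fct_sumE.
Qed.

Lemma is_derive_constM f x v df (c : R) : is_derive x v f df ->
  is_derive x v (fun y => c * f y) (c * df).
Proof. by move=> hf; have := is_deriveZ c hf. Qed.

Lemma is_derive_coord m n (F : V -> 'M[R]_(m, n)) x v i j : differentiable F x ->
  is_derive x v (fun y => F y i j) ('D_v F x i j).
Proof.
move=> dF; have dvF : derivable F x v by exact: diff_derivable.
rewrite derive_mx // mxE; apply: derivableP; exact: (derivable_mxP _ _ _).1.
Qed.

Lemma derive_unique f x v a b : is_derive x v f a -> is_derive x v f b -> a = b.
Proof. by move=> [_ <-] [_ <-]. Qed.

Lemma is_derive_on (U : set V) f g x v df : open U -> U x ->
  (forall y, U y -> f y = g y) -> is_derive x v f df -> is_derive x v g df.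
Proof.
move=> oU Ux fg; apply: near_eq_is_derive.
by have := open_nbhs_nbhs (conj oU Ux); apply: filterS.
Qed.

End DerivativeRules.

(** Determinants and inverse matrices are polynomial, respectively rational, in
    their entries.  The same argument serves for continuity and for
    derivability, with [P] the property in question. *)
Section PolynomialClosure.
Variables (R : realType) (T : Type) (P : (T -> R) -> Prop).
Hypothesis P_cst : forall c : R, P (fun=> c).
Hypothesis P_add : forall f g, P f -> P g -> P (fun y => f y + g y).
Hypothesis P_mul : forall f g, P f -> P g -> P (fun y => f y * g y).

Lemma closed_sum (I : Type) (r : seq I) (f : I -> T -> R) :
  (forall i, P (f i)) -> P (fun y => \sum_(i <- r) f i y).
Proof.
move=> h; elim: r => [|i r IH].
  rewrite (_ : (fun _ => _) = fun=> 0) //; by apply/funext => y; rewrite big_nil.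
rewrite (_ : (fun _ => _) = fun y => f i y + \sum_(j <- r) f j y); last first.
  by apply/funext => y; rewrite big_cons.
exact: P_add.
Qed.

Lemma closed_prod (I : Type) (r : seq I) (f : I -> T -> R) :
  (forall i, P (f i)) -> P (fun y => \prod_(i <- r) f i y).
Proof.
move=> h; elim: r => [|i r IH].
  rewrite (_ : (fun _ => _) = fun=> 1) //; by apply/funext => y; rewrite big_nil.
rewrite (_ : (fun _ => _) = fun y => f i y * \prod_(j <- r) f j y); last first.
  by apply/funext => y; rewrite big_cons.
exact: P_mul.
Qed.

Lemma closed_det n (M : T -> 'M[R]_n) : (forall i j, P (fun y => M y i j)) ->
  P (fun y => \det (M y)).
Proof.
move=> h; apply: closed_sum => s; apply: P_mul => //; exact: closed_prod.
Qed.

Lemma closed_inv_mx n (M : T -> 'M[R]_n) : (forall i j, P (fun y => M y i j)) ->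
  P (fun y => (\det (M y))^-1) ->
  forall i j, P (fun y => ((\det (M y))^-1 *: \adj (M y)) i j).
Proof.
move=> h hi i j.
rewrite (_ : (fun _ => _) = fun y => (\det (M y))^-1 * cofactor (M y) j i); last first.
  by apply/funext => y; rewrite !mxE.
apply: P_mul => //; apply: P_mul => //; apply: closed_det => k l.
rewrite (_ : (fun _ => _) = fun y => M y (lift j k) (lift i l)) //.
by apply/funext => y; rewrite !mxE.
Qed.

End PolynomialClosure.

Section InverseMatrix.
Local Open Scope classical_set_scope.
Variables (R : realType) (V : normedModType R) (n : nat).
Variables (M : V -> 'M[R]_n) (U : set V).
Hypothesis oU : open U.
Hypothesis unitM : forall y, U y -> M y \in unitmx.

Let invE y : U y -> (\det (M y))^-1 *: \adj (M y) = invmx (M y).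
Proof. by move=> /unitM uy; rewrite /invmx uy. Qed.

Lemma derivable_invmx x v : U x ->
  (forall i j, derivable (fun y => M y i j) x v) ->
  forall i j, derivable (fun y => invmx (M y) i j) x v.
Proof.
move=> Ux h i j.
apply: (@near_eq_derivable _ _ _ (fun y => ((\det (M y))^-1 *: \adj (M y)) i j)).
  have := open_nbhs_nbhs (conj oU Ux); apply: filterS => y Uy.
  by rewrite invE.
have Padd (f g : V -> R) : derivable f x v -> derivable g x v ->
  derivable (fun y => f y + g y) x v by exact: derivableD.
have Pmul (f g : V -> R) : derivable f x v -> derivable g x v ->
  derivable (fun y => f y * g y) x v by exact: derivableM.
have Pcst (c : R) : derivable (fun=> c : R) x v by exact: (@derivable_cst R V R^o).
apply: (@closed_inv_mx _ _ (fun f => derivable f x v) Pcst Padd Pmul _ _ h).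
apply: derivableV; first by rewrite -unitfE -unitmxE unitM.
exact: (@closed_det _ _ (fun f => derivable f x v) Pcst Padd Pmul).
Qed.

Lemma continuous_invmx x : U x ->
  (forall i j, {for x, continuous (fun y => M y i j)}) ->
  forall i j, {for x, continuous (fun y => invmx (M y) i j)}.
Proof.
move=> Ux h i j.
have Padd (f g : V -> R) : {for x, continuous f} -> {for x, continuous g} ->
  {for x, continuous (fun y => f y + g y)} by exact: continuousD.
have Pmul (f g : V -> R) : {for x, continuous f} -> {for x, continuous g} ->
  {for x, continuous (fun y => f y * g y)} by exact: continuousM.
have H : {for x, continuous (fun y => ((\det (M y))^-1 *: \adj (M y)) i j)}.
  have Pcst (c : R) : {for x, continuous (fun _ : V => c)} by exact: cst_continuous.
  apply: (@closed_inv_mx _ _ (fun f => {for x, continuous f}) Pcst Padd Pmul _ _ h).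
  apply: continuousV; first by rewrite -unitfE -unitmxE unitM.
  exact: (@closed_det _ _ (fun f => {for x, continuous f}) Pcst Padd Pmul).
by apply: continuous_on_eq oU Ux _ H => y Uy; rewrite invE.
Qed.

End InverseMatrix.

Section Schwarz.
Local Open Scope classical_set_scope.
Variables (R : realType) (V : normedModType R).

Lemma derive_along_segment (f fv : V -> R) (y v : V) (h : R) : 0 < h ->
  (forall s, 0 <= s <= h -> is_derive (y + s *: v) v f (fv (y + s *: v))) ->
  exists2 s, 0 < s < h & f (y + h *: v) - f y = h * fv (y + s *: v).
Proof.
move=> h0 hd; pose g s := f (y + s *: v).
have dg s : 0 <= s <= h -> is_derive s (1 : R) g (fv (y + s *: v)).
  move=> /hd[df <-].
  have e : (fun k : R => k^-1 *: ((f \o shift (y + s *: v)) (k *: v) - f (y + s *: v))) =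
           (fun k : R => k^-1 *: ((g \o shift s) (k *: 1) - g s)).
    apply/funext => k /=; congr (_ *: (_ - _)); rewrite /g; congr f.
    by rewrite [k *: 1]mulr1 scalerDl addrCA.
  by split; rewrite /derivable /derive -e.
have [||c] := @MVT R g (fun s => fv (y + s *: v)) 0 h h0.
- by move=> s; rewrite in_itv /= => /andP[/ltW s0 /ltW sh]; apply: dg; rewrite s0.
- apply: derivable_within_continuous => s; rewrite in_itv /= => hs.
  by have [] := dg s hs.
rewrite in_itv /= /g scale0r addr0 subr0 => hc e; exists c => //.
by rewrite e mulrC.
Qed.

(** The mean value theorem is applied first to f(. + h w) - f in the direction v,
    then to the derivative of f along v in the direction w. *)
Lemma second_difference (U : set V) (f fv fvw : V -> R) (x v w : V) (h : R) : 0 < h ->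
  (forall s t, 0 <= s <= h -> 0 <= t <= h -> U (x + s *: v + t *: w)) ->
  (forall y, U y -> is_derive y v f (fv y)) ->
  (forall y, U y -> is_derive y w fv (fvw y)) ->
  exists s t, [/\ 0 < s < h, 0 < t < h &
    f (x + h *: v + h *: w) - f (x + h *: v) - (f (x + h *: w) - f x)
      = h * (h * fvw (x + s *: v + t *: w))].
Proof.
move=> h0 hU hf hfv.
have h00 : 0 <= (0 : R) <= h by rewrite lexx ltW.
have hh : 0 <= h <= h by rewrite lexx ltW.
pose g y := f (y + h *: w) - f y.
have [|s /andP[s0 sh] e] := @derive_along_segment g (fun y => fv (y + h *: w) - fv y) x v h h0.
  move=> s hs; apply: is_deriveB; last first.
    by apply: hf; have := hU s 0 hs h00; rewrite scale0r addr0.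
  have [df e] := hf _ (hU s h hs hh).
  have E : (fun k : R => k^-1 *: ((f \o shift (x + s *: v + h *: w)) (k *: v)
        - f (x + s *: v + h *: w))) =
     (fun k : R => k^-1 *: (((fun y => f (y + h *: w)) \o shift (x + s *: v)) (k *: v)
        - f (x + s *: v + h *: w))).
    by apply/funext => k /=; rewrite addrA.
  by split; [move: df; rewrite /derivable E | rewrite -e /derive E].
have [t ht e'] : exists2 t, 0 < t < h &
   fv (x + s *: v + h *: w) - fv (x + s *: v) = h * fvw (x + s *: v + t *: w).
  apply: derive_along_segment => // t ht; apply: hfv; apply: hU => //.
  by rewrite !ltW.
exists s, t; split=> //; first by rewrite s0.
by rewrite -e' -e /g.
Qed.

(** Both iterated derivatives are values of the same second difference, at points
    that tend to x. *)
Lemma schwarz (U : set V) (f fv fw fvw fwv : V -> R) (x v w : V) :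
  open U -> U x ->
  (forall y, U y -> is_derive y v f (fv y)) ->
  (forall y, U y -> is_derive y w f (fw y)) ->
  (forall y, U y -> is_derive y w fv (fvw y)) ->
  (forall y, U y -> is_derive y v fw (fwv y)) ->
  {for x, continuous fvw} -> {for x, continuous fwv} -> fvw x = fwv x.
Proof.
move=> oU Ux hfv hfw hfvw hfwv cvw cwv.
apply/eqP; rewrite -subr_eq0 -normr_eq0; apply: contraT => ne.
have e0 : 0 < `|fvw x - fwv x| by rewrite lt_neqAle eq_sym ne normr_ge0.
set e := `|_| in e0.
have e20 : 0 < e / 2 by rewrite divr_gt0.
have n1 : \forall t \near x, `|fvw x - fvw t| < e / 2 by exact: (cvgrPdist_lt _ _).1.
have n2 : \forall t \near x, `|fwv x - fwv t| < e / 2 by exact: (cvgrPdist_lt _ _).1.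
have n3 := open_nbhs_nbhs (conj oU Ux).
have : \forall t \near x,
    (`|fvw x - fvw t| < e / 2 /\ `|fwv x - fwv t| < e / 2) /\ U t.
  by apply: filterI => //; exact: filterI.
move=> /nbhs_ballP[r /= r0 hr].
pose K := `|v| + `|w| + 1.
have K0 : 0 < K by rewrite ltr_wpDl // addr_ge0.
pose h := r / 2 / K.
have h0 : 0 < h by rewrite !divr_gt0.
have inb s t : 0 <= s <= h -> 0 <= t <= h -> ball x r (x + s *: v + t *: w).
  move=> /andP[s0 sh] /andP[t0 th]; rewrite -ball_normE /ball_ /=.
  rewrite -addrA opprD addNKr normrN.
  apply: le_lt_trans (ler_normD _ _) _; rewrite !normrZ !ger0_norm //.
  have : s * `|v| + t * `|w| <= h * K.
    rewrite /K !mulrDr -[leLHS]addr0 !lerD ?ler_wpM2r //; lra.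
  by rewrite /h divfK ?gt_eqF // => /le_lt_trans; apply; lra.
have [|s [t [hs ht e1]]] := @second_difference U f fv fvw x v w h h0 _ hfv hfvw.
  by move=> s t hs ht; have [_] := hr _ (inb s t hs ht).
have [|t' [s' [ht' hs' e2]]] := @second_difference U f fw fwv x w v h h0 _ hfw hfwv.
  by move=> s' t' hs' ht'; have [_] := hr _ (inb t' s' ht' hs'); rewrite addrAC.
have wk (a : R) : 0 < a < h -> 0 <= a <= h by move=> /andP[a0 ah]; rewrite !ltW.
have [[b1 _] _] := hr _ (inb s t (wk _ hs) (wk _ ht)).
have [[_ b2] _] := hr _ (inb s' t' (wk _ hs') (wk _ ht')).
have eq : fvw (x + s *: v + t *: w) = fwv (x + s' *: v + t' *: w).
  have h00 : h != 0 by rewrite gt_eqF.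
  apply: (mulfI h00); apply: (mulfI h00); rewrite [x + s' *: _ + _]addrAC -e1 -e2.
  by rewrite [x + _ + _]addrAC; ring.
have : e <= `|fvw x - fvw (x + s *: v + t *: w)| +
            `|fwv x - fwv (x + s' *: v + t' *: w)|.
  rewrite /e -eq [X in _ <= _ + X]distrC; apply: le_trans (ler_normD _ _).
  by rewrite addrA subrK.
move: b1 b2; rewrite /=; lra.
Qed.

End Schwarz.

Section DeterminantContinuity.
Local Open Scope classical_set_scope.
Variables (R : realType) (n : nat).

(** For P G P^T = 1 the quotient is the characteristic polynomial at t of the
    endomorphism represented by S with respect to G; see [det_frame]. *)
Lemma det_quotient_near (S0 G0 : 'M[R]_n) (t e : R) : G0 \in unitmx -> 0 < e ->
  exists2 r : R, 0 < r & forall S G : 'M[R]_n,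
    (forall i j, `|S i j - S0 i j| < r) -> (forall i j, `|G i j - G0 i j| < r) ->
    `|\det (t *: G - S) / \det G - \det (t *: G0 - S0) / \det G0| < e.
Proof.
move=> uG e0.
pose X := ('M[R]_n * 'M[R]_n)%type.
pose x0 : X := (S0, G0).
pose P (h : X -> R) := {for x0, continuous h}.
have Pcst (k : R) : P (fun=> k) by exact: cst_continuous.
have Padd (h k : X -> R) : P h -> P k -> P (fun y => h y + k y) by exact: continuousD.
have Pmul (h k : X -> R) : P h -> P k -> P (fun y => h y * k y) by exact: continuousM.
have P1 i j : P (fun y => y.1 i j).
  apply: (@continuous_comp _ _ _ fst (fun N : 'M[R]_n => N i j) x0).
    exact: cvg_fst.
  exact: coord_continuous.
have P2 i j : P (fun y => y.2 i j).
  apply: (@continuous_comp _ _ _ snd (fun N : 'M[R]_n => N i j) x0).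
    exact: cvg_snd.
  exact: coord_continuous.
have Pq : P (fun y => \det (t *: y.2 - y.1) * (\det y.2)^-1).
  apply: (Pmul _ _).
    apply: (closed_det Pcst Padd Pmul) => i j.
    rewrite (_ : (fun _ => _) = fun y : X => t * y.2 i j + (-1) * y.1 i j); last first.
      by apply/funext => y; rewrite !mxE mulN1r.
    by apply: (Padd _ _); apply: (Pmul _ _).
  apply: continuousV; last exact: (closed_det Pcst Padd Pmul).
  by rewrite /= -unitfE -unitmxE.
move/cvgrPdist_lt: Pq => /(_ e e0).
move=> /nbhs_ballP[r /= r0 hr]; exists r => // S G hS hG; rewrite distrC.
apply: (hr (S, G)); split; split => // i j; rewrite -ball_normE /ball_ /= distrC.
  exact: hS.
exact: hG.
Qed.

Lemma det_quotients_near (S0 G0 : 'M[R]_n) (T : seq R) (e : R) : G0 \in unitmx -> 0 < e ->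
  exists2 r : R, 0 < r & forall S G : 'M[R]_n,
    (forall i j, `|S i j - S0 i j| < r) -> (forall i j, `|G i j - G0 i j| < r) ->
    forall t, t \in T ->
    `|\det (t *: G - S) / \det G - \det (t *: G0 - S0) / \det G0| < e.
Proof.
move=> uG e0; elim: T => [|t T [r r0 hr]]; first by exists 1.
have [r' r'0 hr'] := det_quotient_near S0 t uG e0.
exists (Num.min r r'); first by rewrite lt_min r0.
move=> S G hS hG u; rewrite inE => /orP[/eqP ->|uT].
  by apply: hr' => i j; [have := hS i j|have := hG i j]; rewrite lt_min => /andP[].
by apply: hr => // i j; [have := hS i j|have := hG i j]; rewrite lt_min => /andP[].
Qed.

End DeterminantContinuity.

Section SmoothMaps.
Local Open Scope classical_set_scope.
Variables (R : realType) (V : normedModType R).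

Lemma smooth_differentiable (W : normedModType R) (U : set V) (f : V -> W) x :
  smooth_on U f -> U x -> differentiable f x.
Proof. by move=> /(_ 1%N) [+ _]; exact. Qed.

Lemma smooth_derive (W : normedModType R) (U : set V) (f : V -> W) v :
  smooth_on U f -> smooth_on U ('D_v f).
Proof. by move=> h k; have [_] := h k.+1; exact. Qed.

Lemma smooth_continuous_coord m n (U : set V) (f : V -> 'M[R]_(m, n)) x i j :
  smooth_on U f -> U x -> {for x, continuous (fun y => f y i j)}.
Proof.
move=> sf Ux; have cf := differentiable_continuous (smooth_differentiable sf Ux).
apply: (@continuous_comp _ _ _ f (fun N : 'M[R]_(m, n) => N i j) x) => //.
exact: coord_continuous.
Qed.

Lemma derive_on m n (U : set V) (f g : V -> 'M[R]_(m, n)) x v : open U -> U x ->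
  (forall y, U y -> f y = g y) -> 'D_v f x = 'D_v g x.
Proof.
move=> oU Ux fg; apply: near_eq_derive.
by have := open_nbhs_nbhs (conj oU Ux); apply: filterS.
Qed.

Lemma schwarz_smooth m n (U : set V) (f : V -> 'M[R]_(m, n)) x v w :
  open U -> smooth_on U f -> U x -> 'D_v ('D_w f) x = 'D_w ('D_v f) x.
Proof.
move=> oU sf Ux; apply/matrixP => i j.
have sv := smooth_derive v sf; have sw := smooth_derive w sf.
have d (h : V -> 'M[R]_(m, n)) u y : smooth_on U h -> U y ->
    is_derive y u (fun z => h z i j) ('D_u h y i j).
  by move=> sh Uy; apply: is_derive_coord; exact: smooth_differentiable sh Uy.
have c (h : V -> 'M[R]_(m, n)) : smooth_on U h ->
    {for x, continuous (fun y => h y i j)}.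
  by move=> sh; exact: smooth_continuous_coord sh Ux.
exact: esym (@schwarz _ _ U (fun y => f y i j) (fun y => 'D_v f y i j)
  (fun y => 'D_w f y i j) (fun y => 'D_w ('D_v f) y i j)
  (fun y => 'D_v ('D_w f) y i j) x v w oU Ux (fun y => d f v y sf)
  (fun y => d f w y sf) (fun y => d _ w y sv) (fun y => d _ v y sw)
  (c _ (smooth_derive w sv)) (c _ (smooth_derive v sw))).
Qed.

Lemma bformE n (E : 'M[R]_n) (u v : 'rV[R]_n) :
  bform E u v = \sum_i \sum_j u 0 i * (E i j * v 0 j).
Proof.
rewrite /bform mxE exchange_big; apply: eq_bigr => j _.
by rewrite !mxE mulr_suml; apply: eq_bigr => i _; rewrite mulrA.
Qed.

Lemma is_derive_bform n (E : 'M[R]_n) (a b : V -> 'rV[R]_n) x v :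
  differentiable a x -> differentiable b x ->
  is_derive x v (fun y => bform E (a y) (b y))
    (bform E ('D_v a x) (b x) + bform E (a x) ('D_v b x)).
Proof.
move=> da db.
rewrite (_ : (fun _ => _) = fun y => \sum_i \sum_j a y 0 i * (E i j * b y 0 j)); last first.
  by apply/funext => y; rewrite bformE.
rewrite !bformE -big_split /=; apply: is_derive_sumf => i.
rewrite -big_split /=; apply: is_derive_sumf => j.
apply: is_derive_mulf; first exact: is_derive_coord.
by apply: is_derive_constM; exact: is_derive_coord.
Qed.

End SmoothMaps.

(** * The Gauss equation in a chart *)
Section LocalGaussEquation.
Local Open Scope classical_set_scope.
Variables (R : realType) (n q : nat) (U : set 'rV[R]_n) (E : 'M[R]_q).
Variables (F : 'rV[R]_n -> 'rV[R]_q) (G : 'rV[R]_n -> 'M[R]_n).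
Hypothesis oU : open U.
Hypothesis sE : E^T = E.
Hypothesis smF : smooth_on U F.

Definition partial (i : 'I_n) := 'D_('e_i) F.
Definition partial2 (i j : 'I_n) := 'D_('e_i) (partial j).

Hypothesis GE : forall y, U y -> forall i j, G y i j = bform E (partial i y) (partial j y).
Hypothesis unitG : forall y, U y -> G y \in unitmx.

Let ip := bform E.
Let B i j k y := ip (partial2 i j y) (partial k y).

(** The inner product of the components of the second derivatives normal to the
    image; the sum is the inner product of the tangential ones. *)
Definition gauss_term y (i j k l : 'I_n) :=
  ip (partial2 i j y) (partial2 k l y) -
  \sum_p \sum_s ip (partial2 i j y) (partial p y) * invmx (G y) p s *
    ip (partial2 k l y) (partial s y).

Let s1 i : smooth_on U (partial i).
Proof. exact: smooth_derive. Qed.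
Let s2 i j : smooth_on U (partial2 i j).
Proof. exact: smooth_derive. Qed.
Let ipC u v : ip u v = ip v u.
Proof. exact: bform_sym. Qed.

Lemma partial2C i j y : U y -> partial2 i j y = partial2 j i y.
Proof. by move=> Uy; exact: schwarz_smooth oU smF Uy. Qed.

Let dmetricE i j k y : U y -> dmetric G y i j k = B i j k y + B i k j y.
Proof.
move=> Uy; have d := is_derive_bform E 'e_i (smooth_differentiable (s1 j) Uy)
  (smooth_differentiable (s1 k) Uy).
have : is_derive y 'e_i (fun z => G z j k) (B i j k y + B i k j y).
  rewrite [B i k j y]ipC.
  exact: (is_derive_on oU Uy (fun z (Uz : U z) => esym (GE Uz j k)) d).
by move=> [_].
Qed.

Let christoffelE i j k y : U y ->
  christoffel G k i j y = \sum_l invmx (G y) k l * B i j l y.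
Proof.
move=> Uy; rewrite /christoffel mulr_sumr; apply: eq_bigr => l _.
rewrite !(dmetricE _ _ _ Uy) /B (partial2C j i Uy) (partial2C l i Uy) (partial2C l j Uy).
generalize (ip (partial2 i j y) (partial l y)) (ip (partial2 i l y) (partial j y))
  (ip (partial2 j l y) (partial i y)) (invmx (G y) k l) => a b c e.
by field.
Qed.

(** Lowering the index of a Christoffel symbol gives the tangential component of
    a second derivative. *)
Let metric_christoffel i j m y : U y ->
  \sum_l G y m l * christoffel G l i j y = B i j m y.
Proof.
move=> Uy; under eq_bigr => l _ do rewrite christoffelE // mulr_sumr.
rewrite exchange_big /=.
transitivity (\sum_s (G y *m invmx (G y)) m s * B i j s y).
  apply: eq_bigr => s _; rewrite mxE mulr_suml; apply: eq_bigr => l _.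
  by rewrite mulrA.
rewrite mulmxV ?unitG // (bigD1 m) //= big1 ?mxE ?eqxx ?mul1r ?addr0 //.
by move=> s sm; rewrite mxE eq_sym (negPf sm) mul0r.
Qed.

Let derivable_christoffel i j k v y : U y -> derivable (christoffel G k i j) y v.
Proof.
move=> Uy.
have dG a b : derivable (fun z => G z a b) y v.
  have d := is_derive_bform E v (smooth_differentiable (s1 a) Uy)
    (smooth_differentiable (s1 b) Uy).
  have [] // : is_derive y v (fun z => G z a b) (ip ('D_v (partial a) y) (partial b y)
    + ip (partial a y) ('D_v (partial b) y)).
  exact: (is_derive_on oU Uy (fun z (Uz : U z) => esym (GE Uz a b)) d).
have dI := derivable_invmx oU unitG Uy dG.
have [] // : is_derive y v (christoffel G k i j) (\sum_l
   ('D_v (fun z => invmx (G z) k l) y * B i j l y + invmx (G y) k l * (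
     ip ('D_v (partial2 i j) y) (partial l y) + ip (partial2 i j y) ('D_v (partial l) y)))).
refine (is_derive_on oU Uy (fun z Uz => esym (christoffelE i j k Uz)) _).
apply: is_derive_sumf => l; apply: is_derive_mulf.
  exact: derivableP.
exact: (is_derive_bform E v (smooth_differentiable (s2 i j) Uy)
  (smooth_differentiable (s1 l) Uy)).
Qed.

(** Differentiating [metric_christoffel] as it stands avoids the derivative of the
    inverse metric. *)
Let metric_derive_christoffel i j k m y : U y ->
  \sum_l G y m l * 'D_('e_i) (christoffel G l j k) y =
  ip ('D_('e_i) (partial2 j k) y) (partial m y) + ip (partial2 j k y) (partial2 i m y)
  - \sum_l (B i m l y + B i l m y) * christoffel G l j k y.
Proof.
move=> Uy.
have h1 : is_derive y 'e_i (fun z => \sum_l G z m l * christoffel G l j k z)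
  (\sum_l ((B i m l y + B i l m y) * christoffel G l j k y +
     G y m l * 'D_('e_i) (christoffel G l j k) y)).
  apply: is_derive_sumf => l; apply: is_derive_mulf.
    have d := is_derive_bform E 'e_i (smooth_differentiable (s1 m) Uy)
      (smooth_differentiable (s1 l) Uy).
    rewrite [B i l m y]ipC.
    exact: (is_derive_on oU Uy (fun z (Uz : U z) => esym (GE Uz m l)) d).
  apply: derivableP; exact: derivable_christoffel.
have h2 : is_derive y 'e_i (fun z => \sum_l G z m l * christoffel G l j k z)
  (ip ('D_('e_i) (partial2 j k) y) (partial m y) + ip (partial2 j k y) (partial2 i m y)).
  refine (is_derive_on oU Uy (fun z Uz => esym (metric_christoffel j k m Uz)) _).
  exact: (is_derive_bform E 'e_i (smooth_differentiable (s2 j k) Uy)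
    (smooth_differentiable (s1 m) Uy)).
have aux (a b c : R) : a + b = c -> b = c - a by move=> <-; ring.
by apply: aux; rewrite -big_split; exact: derive_unique h1 h2.
Qed.

(** The third derivatives of F occur symmetrically in i and j, and cancel. *)
Lemma gauss_equation i j k m y : U y ->
  \sum_l riemann G y i j k l * G y l m = gauss_term y j k i m - gauss_term y i k j m.
Proof.
move=> Uy.
have symG l : G y l m = G y m l by rewrite !GE // bform_sym.
have half i' j' : \sum_l G y m l * ('D_('e_i') (christoffel G l j' k) y +
     \sum_p christoffel G l i' p y * christoffel G p j' k y) =
   ip ('D_('e_i') (partial2 j' k) y) (partial m y) + gauss_term y j' k i' m.
  under eq_bigr => l _ do rewrite mulrDr mulr_sumr.
  rewrite big_split /= metric_derive_christoffel // exchange_big /=.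
  have -> : \sum_p \sum_l G y m l * (christoffel G l i' p y * christoffel G p j' k y) =
      \sum_p B i' p m y * christoffel G p j' k y.
    apply: eq_bigr => p _; rewrite -(metric_christoffel i' p m Uy) mulr_suml.
    by apply: eq_bigr => l _; rewrite mulrA.
  have -> : \sum_l (B i' m l y + B i' l m y) * christoffel G l j' k y =
     \sum_l B i' m l y * christoffel G l j' k y +
     \sum_l B i' l m y * christoffel G l j' k y.
    by rewrite -big_split /=; apply: eq_bigr => l _; rewrite mulrDl.
  have -> : gauss_term y j' k i' m = ip (partial2 j' k y) (partial2 i' m y) -
     \sum_l B i' m l y * christoffel G l j' k y.
    rewrite /gauss_term exchange_big /=; congr (_ - _).
    have -> : \sum_l B i' m l y * christoffel G l j' k y =
      \sum_l \sum_p B i' m l y * (invmx (G y) l p * B j' k p y).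
      by apply: eq_bigr => l _; rewrite christoffelE // mulr_sumr.
    apply: eq_bigr => l _; apply: eq_bigr => p _.
    have -> : invmx (G y) l p = invmx (G y) p l.
      have sG : (G y)^T = G y by apply/matrixP => a b; rewrite mxE !GE // bform_sym.
      by rewrite -{1}sG -trmx_inv mxE.
    have aux (a b c : R) : a * b * c = c * (b * a) by ring.
    exact: aux.
  have aux (t3 t2 a b : R) : t3 + t2 - (a + b) + b = t3 + (t2 - a) by ring.
  exact: aux.
transitivity (\sum_l (G y m l * ('D_('e_i) (christoffel G l j k) y +
     \sum_p christoffel G l i p y * christoffel G p j k y) -
   G y m l * ('D_('e_j) (christoffel G l i k) y +
     \sum_p christoffel G l j p y * christoffel G p i k y))).
  apply: eq_bigr => l _; rewrite symG /riemann sumrB.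
  have aux (g a b s t : R) : (a - b + (s - t)) * g = g * (a + s) - g * (b + t) by ring.
  exact: aux.
rewrite sumrB !half.
have aux (t t' a b : R) : t = t' -> t + a - (t' + b) = a - b by move=> ->; ring.
apply: aux; exact: (congr1 (ip^~ (partial m y)) (schwarz_smooth 'e_i 'e_j oU (s1 k) Uy)).
Qed.

Lemma continuous_gauss_term i j k l y : U y ->
  {for y, continuous (fun z => gauss_term z i j k l)}.
Proof.
move=> Uy.
have cc (c : R) : {for y, continuous (fun _ : 'rV[R]_n => c)} by exact: cst_continuous.
have cb a b : smooth_on U a -> smooth_on U b ->
    {for y, continuous (fun z => ip (a z) (b z) : R)}.
  move=> sa sb.
  rewrite (_ : (fun _ => _) = fun z => \sum_i \sum_j a z 0 i * (E i j * b z 0 j)); last first.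
    by apply/funext => z; rewrite /ip bformE.
  apply: (@closed_sum _ _ (fun f => {for y, continuous f})).
  - exact: cc.
  - by move=> f g; exact: continuousD.
  move=> i'; apply: (@closed_sum _ _ (fun f => {for y, continuous f})).
  - exact: cc.
  - by move=> f g; exact: continuousD.
  move=> j'; apply: continuousM; first exact: smooth_continuous_coord sa Uy.
  apply: continuousM; last exact: smooth_continuous_coord sb Uy.
  exact: cc.
have cG a b : {for y, continuous (fun z => G z a b)}.
  have h : {for y, continuous (fun z => ip (partial a z) (partial b z) : R)} by exact: cb.
  exact: (continuous_on_eq oU Uy (fun z (Uz : U z) => esym (GE Uz a b)) h).
have cI := continuous_invmx oU unitG Uy cG.
apply: continuousB; first exact: cb.
apply: (@closed_sum _ _ (fun f => {for y, continuous f})).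
- exact: cc.
- by move=> f g; exact: continuousD.
move=> p; apply: (@closed_sum _ _ (fun f => {for y, continuous f})).
- exact: cc.
- by move=> f g; exact: continuousD.
move=> s; apply: continuousM; last exact: cb.
by apply: continuousM; [exact: cb|exact: cI].
Qed.

End LocalGaussEquation.

(** * Unit normals in the ambient space *)
Section AmbientGeometry.
Variable R : realType.

Lemma ambient_form_sym m (c : R) : (ambient_form m c)^T = ambient_form m c.
Proof. exact: tr_diag_mx. Qed.

Lemma bform_ambientE m (c : R) (u v : 'rV[R]_m.+1) :
  bform (ambient_form m c) u v =
  (if c < 0 then -1 else 1) * (u 0 ord0 * v 0 ord0) +
  \sum_(i < m) u 0 (lift ord0 i) * v 0 (lift ord0 i).
Proof.
rewrite /bform mxE big_ord_recl; congr (_ + _).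
  by rewrite mul_mx_diag !mxE /= mulrAC mulrC.
by apply: eq_bigr => i _; rewrite mul_mx_diag !mxE /= mulr1.
Qed.

(** The normal of the space form in the ambient space, up to a factor: the
    position vector, or the normal of the hyperplane x_0 = 0 in the flat case. *)
Definition position_normal m (c : R) (y : 'rV[R]_m.+1) : 'rV[R]_m.+1 :=
  if c == 0 then delta_mx 0 ord0 else y.

Definition position_sqr (c : R) : R := if c == 0 then 1 else c^-1.

Lemma position_sqr_neq0 c : position_sqr c != 0.
Proof.
by rewrite /position_sqr; have [_|c0] := eqVneq c 0; rewrite ?oner_eq0 ?invr_eq0.
Qed.

Lemma bform_delta0 m (u : 'rV[R]_m.+1) : bform (ambient_form m 0) u (delta_mx 0 ord0) = u 0 ord0.
Proof.
rewrite bform_ambientE ltxx mxE !eqxx mul1r mulr1 big1 ?addr0 // => i _.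
by rewrite mxE /= mulr0.
Qed.

Lemma position_normal_sqr m (c : R) y : space_form m c y ->
  bform (ambient_form m c) (position_normal c y) (position_normal c y) = position_sqr c.
Proof.
rewrite /space_form /position_normal /position_sqr /=.
have [->|c0] := eqVneq c 0; last by case.
by rewrite bform_delta0 mxE !eqxx.
Qed.

(** The tangent spaces of the space form are positive definite.  In the Lorentzian
    case, the vector u = w_0 y - y_0 w has time component 0, so that
    0 <= (u, u) = w_0^2 / c + y_0^2 (w, w), and 1 / c < 0. *)
Lemma space_form_normal_pos m (c : R) y (w : 'rV[R]_m.+1) : space_form m c y ->
  bform (ambient_form m c) w (position_normal c y) = 0 -> w != 0 ->
  0 < bform (ambient_form m c) w w.
Proof.
have sq (u : 'rV[R]_m.+1) : 0 <= \sum_(i < m) u 0 (lift ord0 i) * u 0 (lift ord0 i).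
  by apply: sumr_ge0 => i _; rewrite -expr2 sqr_ge0.
have sq0 (u : 'rV[R]_m.+1) : u 0 ord0 = 0 ->
    \sum_(i < m) u 0 (lift ord0 i) * u 0 (lift ord0 i) <= 0 -> u = 0.
  move=> u0 us; apply/rowP => i; rewrite mxE; case: (unliftP ord0 i) => [j ->|->] //.
  have /eqP : \sum_(i < m) u 0 (lift ord0 i) * u 0 (lift ord0 i) = 0.
    by apply/eqP; rewrite eq_le us sq.
  rewrite psumr_eq0 => [/allP/(_ j)|k _]; last by rewrite -expr2 sqr_ge0.
  by rewrite mem_index_enum mulf_eq0 orbb => /(_ isT)/eqP.
rewrite /space_form /position_normal /=; have [c0|c0] := ltP c 0; last first.
  move=> _ _ w0; rewrite bform_ambientE (le_gtF c0) mul1r.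
  have h0 : 0 <= w 0 ord0 * w 0 ord0 by rewrite -expr2 sqr_ge0.
  rewrite lt_neqAle addr_ge0 // andbT eq_sym; apply: contra_neq w0.
  move: (sq w) (sq0 w) h0; move: (\sum_(_ < _) _) => s s0 sw h0 e.
  have w00 : w 0 ord0 * w 0 ord0 = 0 by lra.
  apply: sw; last by lra.
  by move/eqP: w00; rewrite mulf_eq0 orbb => /eqP.
rewrite (lt_eqF c0) => -[yy /(_ isT) y0] wy w0.
pose u := w 0 ord0 *: y - y 0 ord0 *: w.
have u0 : u 0 ord0 = 0 by rewrite !mxE mulrC subrr.
have uu : 0 <= bform (ambient_form m c) u u.
  by rewrite bform_ambientE u0 mul0r mulr0 add0r.
have e : bform (ambient_form m c) u u = w 0 ord0 ^+ 2 * c^-1 +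
    y 0 ord0 ^+ 2 * bform (ambient_form m c) w w.
  have wy' : bform (ambient_form m c) y w = 0 by rewrite bform_sym ?ambient_form_sym.
  have uy : bform (ambient_form m c) u y = w 0 ord0 * c^-1.
    by rewrite /u -scaleNr bformDl !bformZl yy wy mulr0 addr0.
  have uw : bform (ambient_form m c) u w = - y 0 ord0 * bform (ambient_form m c) w w.
    by rewrite /u -scaleNr bformDl !bformZl wy' mulr0 add0r.
  rewrite {2}/u bform_sym ?ambient_form_sym // -scaleNr bformDl !bformZl.
  rewrite bform_sym ?ambient_form_sym // uy bform_sym ?ambient_form_sym // uw.
  ring.
rewrite ltNge; apply/negP => ww.
have ci : c^-1 < 0 by rewrite invr_lt0.
have y2 : 0 < y 0 ord0 ^+ 2 by rewrite exprn_gt0.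
have : w 0 ord0 ^+ 2 * c^-1 <= 0 by rewrite mulr_ge0_le0 ?sqr_ge0 // ltW.
have : y 0 ord0 ^+ 2 * bform (ambient_form m c) w w <= 0.
  by rewrite mulr_ge0_le0 // ltW.
rewrite e in uu => h1 h2.
have /eqP : w 0 ord0 ^+ 2 * c^-1 = 0 by lra.
rewrite mulf_eq0 invr_eq0 (lt_eqF c0) orbF expf_eq0 /= => /eqP w00.
move/eqP: w0; apply; apply: sq0 => //.
by move: ww; rewrite bform_ambientE w00 mul0r mulr0 add0r.
Qed.

(** The n + 1 linear equations for N have a nonzero solution in dimension n + 2. *)
Lemma exists_unit_normal n (E : 'M[R]_n.+2) (T : 'M[R]_(n, n.+2)) (nu : 'rV[R]_n.+2) :
  E^T = E -> (forall w, bform E w nu = 0 -> w != 0 -> 0 < bform E w w) ->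
  exists N : 'rV[R]_n.+2,
    [/\ bform E N N = 1, bform E N nu = 0 & N *m E *m T^T = 0].
Proof.
move=> sE pos.
pose W : 'M[R]_(1 + n, n.+2) := col_mx nu T.
have : kermx (E *m W^T) != 0.
  rewrite -mxrank_eq0 mxrank_ker subn_eq0 -ltnNge.
  by rewrite (leq_ltn_trans (rank_leq_col _)).
move=> /rowV0Pn[w /sub_kermxP wK w0].
have : w *m E *m W^T = 0 by rewrite -mulmxA.
rewrite /W tr_col_mx mul_mx_row -row_mx0 => /eq_row_mx[wnu wT].
have wnu0 : bform E w nu = 0 by rewrite /bform wnu mxE.
have ww := pos _ wnu0 w0.
exists ((Num.sqrt (bform E w w))^-1 *: w); split.
- by rewrite bformZl bformZr mulrA -expr2 exprVn sqr_sqrtr ?ltW // mulVf // gt_eqF.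
- by rewrite bformZl wnu0 mulr0.
- by rewrite -!scalemxAl wT scaler0.
Qed.

Lemma bform_rowr n q (E : 'M[R]_q) (T : 'M[R]_(n, q)) (X : 'rV[R]_q) p :
  bform E X (row p T) = (X *m E *m T^T) 0 p.
Proof. by rewrite /bform !mxE; apply: eq_bigr => k _; rewrite !mxE. Qed.

(** If Q has the rows nu, N, T and Q E Q^T = D is the (invertible) block diagonal
    Gram matrix, then E = E Q^T D^-1 Q E, and E is expanded along these rows. *)
Lemma parseval n (E : 'M[R]_n.+2) (T : 'M[R]_(n, n.+2)) (nu N X Y : 'rV[R]_n.+2)
    (G : 'M[R]_n) (e : R) :
  E^T = E -> T *m E *m T^T = G -> G \in unitmx -> nu *m E *m T^T = 0 ->
  N *m E *m T^T = 0 -> bform E N nu = 0 -> bform E N N = 1 ->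
  bform E nu nu = e -> e != 0 ->
  bform E X Y = (\sum_p \sum_s bform E X (row p T) * invmx G p s * bform E Y (row s T))
    + e^-1 * bform E X nu * bform E Y nu + bform E X N * bform E Y N.
Proof.
move=> sE hG uG nT NT Nnu NN nunu e0.
have bM u v : u *m E *m v^T = (bform E u v)%:M by rewrite [LHS]mx11_scalar.
have h1 : col_mx nu N *m E *m (col_mx nu N)^T = block_mx e%:M 0 0 1%:M.
  rewrite tr_col_mx mul_col_mx mul_col_row !bM NN nunu Nnu (bform_sym nu N sE) Nnu.
  by rewrite raddf0.
have h2 : col_mx nu N *m E *m T^T = 0 by rewrite !mul_col_mx nT NT col_mx0.
have h3 : T *m E *m (col_mx nu N)^T = 0.
  by apply: trmx_inj; rewrite !trmx_mul trmxK sE mulmxA h2 trmx0.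
pose Q : 'M[R]_(1 + 1 + n, n.+2) := col_mx (col_mx nu N) T.
pose D : 'M[R]_(1 + 1 + n) := block_mx (block_mx e%:M 0 0 1%:M) 0 0 G.
pose D' : 'M[R]_(1 + 1 + n) := block_mx (block_mx e^-1%:M 0 0 1%:M) 0 0 (invmx G).
have QD : Q *m E *m Q^T = D.
  by rewrite /Q tr_col_mx mul_col_mx mul_col_row h1 h2 h3 hG.
have DD : D *m D' = 1%:M.
  rewrite /D /D' !mulmx_block !mul0mx !mulmx0 !addr0 !add0r mulmxV //.
  by rewrite -scalar_mxM divff // mulmx1 -!scalar_mx_block.
have QQ : E *m Q^T *m D' *m Q = 1%:M.
  by apply: mulmx1C; rewrite !mulmxA QD DD.
have : X *m E *m Y^T = X *m E *m Q^T *m D' *m (Q *m E *m Y^T).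
  by rewrite -{1}[E]mul1mx -QQ !mulmxA.
rewrite /Q /D' tr_col_mx mul_mx_row !mul_col_mx mul_row_block.
rewrite !mulmx0 addr0 add0r mul_row_col.
rewrite tr_col_mx mul_mx_row mul_row_block !mulmx0 addr0 add0r mulmx1 mul_row_col.
have -> : \sum_p \sum_s bform E X (row p T) * invmx G p s * bform E Y (row s T) =
    (X *m E *m T^T *m invmx G *m (T *m E *m Y^T)) 0 0.
  rewrite mxE exchange_big; apply: eq_bigr => s _; rewrite -mulr_suml; congr (_ * _).
    by rewrite mxE; apply: eq_bigr => p _; rewrite bform_rowr.
  by rewrite bform_sym // /bform -!row_mul mxE.
move: (X *m E *m T^T *m _ *m _) => M3; rewrite !bM -!scalar_mxM.
move=> /(congr1 (fun M : 'M[R]_1 => M 0 0)); rewrite !mxE eqxx !mulr1n => ->.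
rewrite (bform_sym nu Y sE) (bform_sym N Y sE); ring.
Qed.

End AmbientGeometry.

(** * Hypersurfaces of a space form in a chart *)
Section HypersurfaceChart.
Local Open Scope classical_set_scope.
Variables (R : realType) (n : nat) (c : R) (U : set 'rV[R]_n).
Variables (F : 'rV[R]_n -> 'rV[R]_n.+2) (G : 'rV[R]_n -> 'M[R]_n).
Hypothesis oU : open U.
Hypothesis smF : smooth_on U F.
Hypothesis FQ : forall y, U y -> space_form n.+1 c (F y).
Let E := ambient_form n.+1 c.
Hypothesis GE : forall y, U y -> forall i j, G y i j = bform E (partial F i y) (partial F j y).
Hypothesis unitG : forall y, U y -> G y \in unitmx.

Let sE : E^T = E := ambient_form_sym _ _.
Let nu y := position_normal c (F y).

(** A unit normal of the hypersurface inside the space form, at the point F y. *)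
Definition unit_normal y (N : 'rV[R]_n.+2) :=
  [/\ bform E N N = 1, bform E N (nu y) = 0 & forall i, bform E (partial F i y) N = 0].

Definition shape_form y (N : 'rV[R]_n.+2) : 'M[R]_n :=
  \matrix_(i, j) bform E (partial2 F i j y) N.

Let s1 i : smooth_on U (partial F i).
Proof. exact: smooth_derive. Qed.
Let s2 i j : smooth_on U (partial2 F i j).
Proof. exact: smooth_derive. Qed.

Let derive_const (f : 'rV[R]_n -> R) y v df k : U y -> (forall z, U z -> f z = k) ->
  is_derive y v f df -> df = 0.
Proof.
move=> Uy fk hf.
have h : is_derive y v (cst k : 'rV[R]_n -> R) (0 : R) by exact: is_derive_cst.
have h' := is_derive_on oU Uy (fun z Uz => esym (fk z Uz)) h.
exact: derive_unique hf h'.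
Qed.

Let first_coord0 y : c = 0 -> U y -> F y 0 ord0 = 0.
Proof. by move=> c0 Uy; have := FQ Uy; rewrite /space_form /= c0 eqxx. Qed.

Let partial_first_coord0 i y : c = 0 -> U y -> partial F i y 0 ord0 = 0.
Proof.
move=> c0 Uy; apply: (derive_const Uy (fun z Uz => first_coord0 c0 Uz)).
exact: is_derive_coord (smooth_differentiable smF Uy).
Qed.

Let partial2_first_coord0 i j y : c = 0 -> U y -> partial2 F i j y 0 ord0 = 0.
Proof.
move=> c0 Uy; apply: (derive_const Uy (fun z Uz => partial_first_coord0 j c0 Uz)).
exact: is_derive_coord (smooth_differentiable (s1 j) Uy).
Qed.

Let sqr_position y : c != 0 -> U y -> bform E (F y) (F y) = c^-1.
Proof. by move=> c0 Uy; have := FQ Uy; rewrite /space_form /= (negPf c0) => -[]. Qed.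

Let partial_position i y : c != 0 -> U y -> bform E (partial F i y) (F y) = 0.
Proof.
move=> c0 Uy; have dF := smooth_differentiable smF Uy.
have := derive_const Uy (fun z Uz => sqr_position c0 Uz) (is_derive_bform E 'e_i dF dF).
rewrite (bform_sym (F y) _ sE) -/(partial F i y).
by move: (bform _ _ _) => a h; lra.
Qed.

Let partial2_position i j y : c != 0 -> U y -> bform E (partial2 F i j y) (F y) = - G y i j.
Proof.
move=> c0 Uy; have := derive_const Uy (fun z Uz => partial_position j c0 Uz)
  (is_derive_bform E 'e_i (smooth_differentiable (s1 j) Uy) (smooth_differentiable smF Uy)).
have aux (a b x : R) : b = x -> a + b = 0 -> a = - x by move=> ->; lra.
exact: aux (etrans (bform_sym _ _ sE) (esym (GE Uy i j))).
Qed.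

Lemma partial_nu i y : U y -> bform E (partial F i y) (nu y) = 0.
Proof.
move=> Uy; rewrite /nu /position_normal; have [c0|c0] := eqVneq c 0.
  by rewrite /E c0 bform_delta0; exact: partial_first_coord0.
exact: partial_position.
Qed.

Lemma partial2_nu i j y : U y ->
  bform E (partial2 F i j y) (nu y) = if c == 0 then 0 else - G y i j.
Proof.
move=> Uy; rewrite /nu /position_normal; have [c0|c0] := eqVneq c 0.
  by rewrite /E c0 bform_delta0; exact: partial2_first_coord0.
exact: partial2_position.
Qed.

Let T y : 'M[R]_(n, n.+2) := \matrix_i partial F i y.

Let TET y : U y -> T y *m E *m (T y)^T = G y.
Proof.
move=> Uy; apply/matrixP => i j; rewrite GE //.
have := bform_rowr E (T y) (row i (T y)) j.
rewrite !rowK => ->; by rewrite -[partial F i y](rowK (fun k => partial F k y)) -!row_mul [RHS]mxE.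
Qed.

Let orthoT y N : (forall i, bform E (partial F i y) N = 0) -> N *m E *m (T y)^T = 0.
Proof.
move=> h; apply/rowP => i; rewrite [RHS]mxE -bform_rowr rowK.
by rewrite bform_sym.
Qed.

Lemma exists_chart_normal y : U y -> exists N, unit_normal y N.
Proof.
move=> Uy; have [w h w0|N [h1 h2 h3]] := @exists_unit_normal _ _ _ (T y) (nu y) sE.
  exact: space_form_normal_pos (FQ Uy) h w0.
exists N; split=> // i.
have := bform_rowr E (T y) N i; rewrite rowK => e.
by rewrite bform_sym // e h3 mxE.
Qed.

Lemma shape_form_sym y N : U y -> (shape_form y N)^T = shape_form y N.
Proof.
by move=> Uy; apply/matrixP => i j; rewrite !mxE (partial2C oU smF j i Uy).
Qed.

(** The normal space of the hypersurface in the ambient space is spanned by [N]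
    and [nu]; the component along [nu] produces the curvature of the space form. *)
Lemma gauss_term_shape y N i j k l : U y -> unit_normal y N ->
  gauss_term E F G y i j k l =
  shape_form y N i j * shape_form y N k l + c * (G y i j * G y k l).
Proof.
move=> Uy [NN Nnu NT].
have nT : nu y *m E *m (T y)^T = 0 by apply: orthoT => p; exact: partial_nu.
have par := parseval (partial2 F i j y) (partial2 F k l y) sE (TET Uy) (unitG Uy) nT (orthoT NT)
  Nnu NN (position_normal_sqr (FQ Uy)) (position_sqr_neq0 c).
have aux (b s s' e e' x x' : R) : b = s' + e + x -> s = s' -> e = e' -> x = x' ->
  b - s = x' + e' by move=> -> -> -> ->; ring.
apply: (aux _ _ _ _ _ _ _ par).
- by apply: eq_bigr => p _; apply: eq_bigr => s _; rewrite !rowK.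
- have aux2 (p n1 n2 n1' n2' r : R) : n1 = n1' -> n2 = n2' -> p * n1' * n2' = r ->
    p * n1 * n2 = r by move=> -> ->.
  apply: (aux2 _ _ _ _ _ _ (partial2_nu i j Uy) (partial2_nu k l Uy)); rewrite /position_sqr.
  by have [->|c0] := eqVneq c 0; [rewrite !mulr0 mul0r|rewrite invrK; ring].
- by rewrite /shape_form !mxE.
Qed.

Lemma lowered_riemann y N i j k m : U y -> unit_normal y N ->
  let S := shape_form y N in
  \sum_l riemann G y i j k l * G y l m =
    (S j k * S i m - S i k * S j m) + c * (G y j k * G y i m - G y i k * G y j m).
Proof.
move=> Uy hN S; rewrite (gauss_equation oU sE smF GE unitG) //.
rewrite !(gauss_term_shape _ _ _ _ Uy hN) -/S; ring.
Qed.

End HypersurfaceChart.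

(** * Curvature and Ricci operator in a principal frame *)
Lemma rank_diag_mx (K : fieldType) n (e : 'rV[K]_n) :
  \rank (diag_mx e) = (\sum_(i < n) (e 0%R i != 0%R))%N.
Proof.
elim: n e => [|n IH] e; first by rewrite big_ord0; apply/eqP; rewrite -leqn0 rank_leq_row.
have r (e' : 'rV[K]_(1 + n)) : \rank (diag_mx e') =
    (\rank (diag_mx (lsubmx e')) + \rank (diag_mx (rsubmx e')))%N.
  by rewrite -rank_diag_block_mx -diag_mx_row hsubmxK.
rewrite (r e) IH big_ord_recl; congr (_ + _)%N.
  rewrite rank_rV; congr (nat_of_bool (~~ _)); apply/eqP/eqP => [/matrixP/(_ 0 0)|h].
    rewrite !mxE eqxx mulr1n => <-; congr (e _ _); exact: val_inj.
  apply/matrixP => i j; rewrite !ord1 !mxE eqxx mulr1n -h; congr (e _ _).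
  exact: val_inj.
apply: eq_bigr => i _; rewrite mxE; congr (nat_of_bool (e _ _ != _)).
exact: val_inj.
Qed.

Section AlgebraicCurvature.
Variables (R : realType) (n : nat) (c : R) (S : 'M[R]_n).
Variables (G : 'rV[R]_n -> 'M[R]_n) (y : 'rV[R]_n).
Hypothesis riemE : forall i j k m, \sum_l riemann G y i j k l * G y l m =
    (S j k * S i m - S i k * S j m) + c * (G y j k * G y i m - G y i k * G y j m).

Lemma curvature_tensorE (u v w z : 'rV[R]_n) :
  curvature_tensor G y u v w z =
    (bform S v w * bform S u z - bform S u w * bform S v z)
    + c * (bform (G y) v w * bform (G y) u z - bform (G y) u w * bform (G y) v z).
Proof.
have e1 (A : 'M[R]_n) (a b a' b' : 'rV[R]_n) : bform A a b * bform A a' b' =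
   \sum_i \sum_j \sum_k \sum_m a 0 i * a' 0 j * b 0 k * b' 0 m * (A i k * A j m).
  rewrite !bformE big_distrl; apply: eq_bigr => i _ /=.
  rewrite mulr_sumr; apply: eq_bigr => j _ /=.
  rewrite big_distrlr /=; apply: eq_bigr => k _; apply: eq_bigr => m _.
  ring.
have e2 (A : 'M[R]_n) (a b a' b' : 'rV[R]_n) : bform A a' b * bform A a b' =
   \sum_i \sum_j \sum_k \sum_m a 0 i * a' 0 j * b 0 k * b' 0 m * (A j k * A i m).
  rewrite e1 exchange_big; apply: eq_bigr => i _; apply: eq_bigr => j _.
  by apply: eq_bigr => k _; apply: eq_bigr => m _; rewrite [a' 0 j * _]mulrC.
rewrite (e2 S u w v z) (e1 S u w v z) (e2 (G y) u w v z) (e1 (G y) u w v z).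
rewrite -!sumrB !mulr_sumr -big_split; apply: eq_bigr => i _ /=.
rewrite -!sumrB !mulr_sumr -big_split; apply: eq_bigr => j _ /=.
rewrite -!sumrB !mulr_sumr -big_split; apply: eq_bigr => k _ /=.
rewrite -!sumrB !mulr_sumr -big_split exchange_big; apply: eq_bigr => m _ /=.
transitivity (u 0 i * v 0 j * w 0 k * z 0 m * \sum_l riemann G y i j k l * G y l m).
  rewrite mulr_sumr; apply: eq_bigr => l _; ring.
rewrite riemE; ring.
Qed.

Hypothesis unitG : G y \in unitmx.
Hypothesis symG : (G y)^T = G y.

Let A := S *m invmx (G y).

Lemma ricci_operatorE :
  ricci_operator G y = \tr A *: A - A *m A + (c * (n%:R - 1))%:M.
Proof.
have rE j k : ricci G y j k =
    \sum_i \sum_m ((S j k * S i m - S i k * S j m) +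
      c * (G y j k * G y i m - G y i k * G y j m)) * invmx (G y) m i.
  rewrite mxE; apply: eq_bigr => i _.
  under eq_bigr => m _ do rewrite -riemE mulr_suml.
  rewrite exchange_big (bigD1 i) //= [X in _ + X]big1 ?addr0 => [|l li].
    under eq_bigr => m _ do rewrite -mulrA.
    rewrite -mulr_sumr; have /matrixP/(_ i i) := mulmxV unitG.
    by rewrite !mxE eqxx => ->; rewrite mulr1.
  under eq_bigr => m _ do rewrite -mulrA.
  rewrite -mulr_sumr; have /matrixP/(_ l i) := mulmxV unitG.
  by rewrite !mxE (negPf li) => ->; rewrite mulr0.
have ricE : ricci G y = \tr A *: S - A *m S + (c * (n%:R - 1)) *: G y.
  have key (X Y Z : 'M[R]_n) j k : \sum_i \sum_m X i k * Y j m * invmx (G y) m i =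
      (Y *m invmx (G y) *m X) j k.
    rewrite !mxE; apply: eq_bigr => i _; rewrite mxE mulr_suml.
    apply: eq_bigr => m _; ring.
  have keyt (X : 'M[R]_n) : \sum_i \sum_m X i m * invmx (G y) m i = \tr (X *m invmx (G y)).
    by apply: eq_bigr => i _; rewrite mxE.
  apply/matrixP => j k; rewrite rE.
  transitivity (S j k * (\sum_i \sum_m S i m * invmx (G y) m i)
     - \sum_i \sum_m S i k * S j m * invmx (G y) m i
     + c * (G y j k * (\sum_i \sum_m G y i m * invmx (G y) m i)
     - \sum_i \sum_m G y i k * G y j m * invmx (G y) m i)).
    rewrite !mulr_sumr -!sumrB mulr_sumr -big_split; apply: eq_bigr => i _ /=.
    rewrite !mulr_sumr -!sumrB mulr_sumr -big_split; apply: eq_bigr => m _ /=.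
    ring.
  rewrite !key // !keyt mulmxV // mxtrace1 mul1mx -/A !mxE; ring.
rewrite /ricci_operator ricE mulmxDl mulmxBl -!scalemxAl -mulmxA -/A mulmxV //.
by rewrite scalemx1.
Qed.

Variables (P : 'M[R]_n) (d : 'I_n -> R).
Hypothesis PG : P *m G y *m P^T = 1%:M.
Hypothesis PS : P *m S *m P^T = diag_mx (\row_i d i).

Lemma frame_unit : P \in unitmx.
Proof. by have [] := mulmx1_unit (etrans (mulmxA _ _ _) PG). Qed.

Lemma frame_shape_operator : A = invmx P *m diag_mx (\row_i d i) *m P.
Proof.
have uP := frame_unit; rewrite -PS !mulmxA mulVmx // mul1mx /A -!mulmxA; congr (_ *m _).
apply: (can_inj (mulmxK unitG)); rewrite mulVmx //.
have /mulmx1C : P *m (G y *m P^T) = 1%:M by rewrite mulmxA.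
move=> h; apply: trmx_inj; rewrite !trmx_mul trmxK symG trmx1.
by rewrite mulmxA.
Qed.

Lemma trace_shape_operator : \tr A = trace d.
Proof.
rewrite frame_shape_operator -mulmxA mxtrace_mulC -mulmxA mulmxV ?frame_unit // mulmx1.
by rewrite mxtrace_diag; apply: eq_bigr => i _; rewrite mxE.
Qed.

Lemma frame_ricci_operator : ricci_operator G y =
  invmx P *m diag_mx (\row_i (ricci_part d i + c * (n%:R - 1))) *m P.
Proof.
have uP := frame_unit.
rewrite ricci_operatorE trace_shape_operator frame_shape_operator.
have -> : diag_mx (\row_i (ricci_part d i + c * (n%:R - 1))) =
   trace d *: diag_mx (\row_i d i) - diag_mx (\row_i d i) *m diag_mx (\row_i d i)
   + (c * (n%:R - 1))%:M.
  apply/matrixP => i j; rewrite mulmx_diag !mxE /ricci_part.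
  by case: eqP => // _; rewrite ?mulr1n ?mulr0n; ring.
rewrite !(mulmxDr, mulmxDl, mulmxN, mulNmx) -!scalemxAr -!scalemxAl; congr (_ - _ + _).
  by rewrite !mulmxA mulmxK.
by rewrite mul_mx_scalar -scalemxAl mulVmx // scalemx1.
Qed.

Lemma rank_eigenspace_ricci (lam : R) :
  \rank (eigenspace (ricci_operator G y) lam) =
  #|[set i | ricci_part d i + c * (n%:R - 1) == lam]|.
Proof.
have uP := frame_unit.
rewrite /eigenspace mxrank_ker frame_ricci_operator.
have -> : lam%:M = invmx P *m lam%:M *m P.
  by rewrite mul_mx_scalar -scalemxAl mulVmx // scalemx1.
rewrite -mulmxBl -mulmxBr mxrankMfree ?row_free_unit //.
rewrite eqmxMfull ?row_full_unit ?unitmx_inv //.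
have -> : diag_mx (\row_i (ricci_part d i + c * (n%:R - 1))) - lam%:M =
    diag_mx (\row_i (ricci_part d i + c * (n%:R - 1) - lam)).
  by apply/matrixP => i j; rewrite !mxE mulrnBl.
rewrite rank_diag_mx; set X := [set i | _].
pose e := \row_i (ricci_part d i + c * (n%:R - 1) - lam).
rewrite -/e; have -> : (\sum_(i < n) (e ord0 i != 0%R))%N = #|~: X|.
  rewrite -sum1_card [RHS]big_mkcond /=; apply: eq_bigr => i _.
  by rewrite mxE !inE subr_eq0; case: eqP.
have cX : (#|X| + #|~: X|)%N = n by rewrite cardsC card_ord.
by apply/eqP; rewrite -(eqn_add2r #|~: X|) subnK ?cX // -[leqRHS]cX leq_addl.
Qed.

End AlgebraicCurvature.

(** * Change of charts *)
Section ChainRule.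
Local Open Scope classical_set_scope.
Variable R : realType.

Lemma derive_comp_sum n p q (tau : 'rV[R]_n -> 'rV[R]_p) (h : 'rV[R]_p -> 'rV[R]_q)
    (x v : 'rV[R]_n) : differentiable tau x -> differentiable h (tau x) ->
  'D_v (h \o tau) x = \sum_k ('D_v tau x) 0 k *: 'D_('e_k) h (tau x).
Proof.
move=> dt dh; rewrite deriveE; last exact: differentiable_comp.
rewrite diff_comp //= -deriveE // -deriveE // {1}deriveEjacobian //.
rewrite [X in X *m _](row_sum_delta) mulmx_suml; apply: eq_bigr => k _.
by rewrite -scalemxAl; congr (_ *: _); rewrite deriveEjacobian.
Qed.

Variables (n p q : nat) (O : set 'rV[R]_n) (U : set 'rV[R]_p).
Variables (tau : 'rV[R]_n -> 'rV[R]_p) (F : 'rV[R]_n -> 'rV[R]_q) (H : 'rV[R]_p -> 'rV[R]_q).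
Hypothesis oO : open O.
Hypothesis smT : smooth_on O tau.
Hypothesis smH : smooth_on U H.
Hypothesis tauU : forall z, O z -> U (tau z).
Hypothesis FE : forall z, O z -> F z = H (tau z).

Lemma partial_comp i z : O z -> partial F i z = \sum_k (partial tau i z) 0 k *: partial H k (tau z).
Proof.
move=> Oz; rewrite /partial (derive_on 'e_i oO Oz FE); apply: derive_comp_sum.
  exact: smooth_differentiable smT Oz.
exact: smooth_differentiable smH (tauU Oz).
Qed.

(** The first summand is tangent to the image of H and disappears when paired
    with a normal. *)
Lemma partial2_comp i j z : differentiable (partial F j) z -> O z ->
  partial2 F i j z = \sum_k ((partial2 tau i j z) 0 k *: partial H k (tau z) +
    (partial tau j z) 0 k *: \sum_l (partial tau i z) 0 l *: partial2 H l k (tau z)).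
Proof.
move=> dF Oz; apply/rowP => a; rewrite summxE.
have h1 := is_derive_coord 'e_i 0 a dF.
have dT k : is_derive z 'e_i (fun y => partial tau j y 0 k) (partial2 tau i j z 0 k).
  apply: is_derive_coord; exact: smooth_differentiable (smooth_derive 'e_j smT) Oz.
have dH k : is_derive z 'e_i (fun y => partial H k (tau y) 0 a)
    ((\sum_l (partial tau i z) 0 l *: partial2 H l k (tau z)) 0 a).
  have dHk : differentiable (partial H k) (tau z).
    exact: smooth_differentiable (smooth_derive 'e_k smH) (tauU Oz).
  have dt : differentiable tau z by exact: smooth_differentiable smT Oz.
  have := is_derive_coord 'e_i 0 a (differentiable_comp dt dHk).
  by rewrite derive_comp_sum.
have h2 : is_derive z 'e_i (fun y => \sum_k partial tau j y 0 k * partial H k (tau y) 0 a)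
   (\sum_k (partial2 tau i j z 0 k * partial H k (tau z) 0 a + partial tau j z 0 k *
      (\sum_l (partial tau i z) 0 l *: partial2 H l k (tau z)) 0 a)).
  by apply: is_derive_sumf => k; exact: is_derive_mulf.
have h3 : is_derive z 'e_i (fun y => partial F j y 0 a)
   (\sum_k (partial2 tau i j z 0 k * partial H k (tau z) 0 a + partial tau j z 0 k *
      (\sum_l (partial tau i z) 0 l *: partial2 H l k (tau z)) 0 a)).
  refine (is_derive_on oO Oz _ h2) => y Oy; rewrite (partial_comp j Oy) summxE.
  by apply: eq_bigr => k _; rewrite mxE.
rewrite (derive_unique h1 h3); apply: eq_bigr => k _.
by rewrite [RHS]mxE [X in _ = X + _]mxE [X in _ = _ + X]mxE.
Qed.

End ChainRule.

(** * Local constancy of the curvature type *)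
Lemma near_value (R : realType) (T : topologicalType) (h : T -> R) (x : T) (e : R) :
  ({for x, continuous h} -> 0 < e -> \forall y \near x, `|h y - h x| < e)%classic.
Proof.
move=> /cvgrPdist_lt ch e0; have := ch _ e0.
by apply: filterS => y; rewrite distrC.
Qed.

Lemma near_values (R : realType) (T : topologicalType) (I : finType) (h : I -> T -> R)
    (x : T) (e : R) :
  ((forall i, {for x, continuous (h i)}) -> 0 < e ->
    \forall y \near x, forall i, `|h i y - h i x| < e)%classic.
Proof. by move=> ch e0; apply: filter_forall => i; exact: near_value. Qed.

Lemma near_and3 (T : topologicalType) (x : T) (P Q S : T -> Prop) :
  ((\forall y \near x, P y) -> (\forall y \near x, Q y) -> (\forall y \near x, S y) ->
    \forall y \near x, [/\ P y, Q y & S y])%classic.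
Proof. by apply: filterS3 => y. Qed.

Section Frames.
Variables (R : realType) (n : nat).

Lemma bform_frame (B P : 'M[R]_n) (d : 'I_n -> R) (u v : 'rV[R]_n) :
  P *m B *m P^T = diag_mx (\row_i d i) ->
  bform B (u *m P) (v *m P) = \sum_i d i * u 0 i * v 0 i.
Proof.
move=> h; rewrite /bform trmx_mul.
have -> : u *m P *m B *m (P^T *m v^T) = u *m (P *m B *m P^T) *m v^T by rewrite !mulmxA.
rewrite h mul_mx_diag mxE; apply: eq_bigr => i _.
by rewrite !mxE [u 0 i * _]mulrC.
Qed.

Lemma perm_mx_coord (s : {perm 'I_n}) (u : 'rV[R]_n) i : (u *m perm_mx s) 0 (s i) = u 0 i.
Proof.
rewrite mxE (bigD1 i) //= big1 ?addr0 => [|k ki]; rewrite !mxE ?eqxx ?mulr1 //.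
by rewrite (inj_eq perm_inj) (negPf ki) mulr0.
Qed.

(** The terms with i = j cancel, and the others only involve d_i d_j. *)
Lemma curvature_products (d d' u v w z : 'I_n -> R) :
  (forall i j, i != j -> d i * d j = d' i * d' j) ->
  (\sum_i d i * v i * w i) * (\sum_i d i * u i * z i)
   - (\sum_i d i * u i * w i) * (\sum_i d i * v i * z i) =
  (\sum_i d' i * v i * w i) * (\sum_i d' i * u i * z i)
   - (\sum_i d' i * u i * w i) * (\sum_i d' i * v i * z i).
Proof.
move=> h; rewrite !big_distrlr /= -!sumrB; apply: eq_bigr => i _.
rewrite -!sumrB; apply: eq_bigr => j _.
have [->|ij] := eqVneq i j; first by ring.
have aux (k : 'I_n -> R) : k i * v i * w i * (k j * u j * z j)
    - k i * u i * w i * (k j * v j * z j) =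
  (k i * k j) * (v i * w i * u j * z j - u i * w i * v j * z j) by ring.
by rewrite !aux h.
Qed.

(** Both determinants are multiplied by the square of det P. *)
Lemma det_frame (S G P : 'M[R]_n) (d : 'I_n -> R) (t : R) :
  P *m G *m P^T = 1%:M -> P *m S *m P^T = diag_mx (\row_i d i) ->
  \det (t *: G - S) / \det G = (spectral_poly d).[t].
Proof.
move=> PG PS.
have dG : \det P * \det G * \det P = 1 by rewrite -[X in _ * X]det_tr -!det_mulmx PG det1.
have P0 : \det P != 0 by apply: contra_eq_neq dG => ->; rewrite mulr0 eq_sym oner_neq0.
have G0 : \det G != 0 by apply: contra_eq_neq dG => ->; rewrite mulr0 mul0r eq_sym oner_neq0.
have -> : (spectral_poly d).[t] = \det (P *m (t *: G - S) *m P^T).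
  rewrite mulmxBr mulmxBl -scalemxAr -scalemxAl PG PS /spectral_poly horner_prod.
  have -> : t *: 1%:M - diag_mx (\row_i d i) = diag_mx (\row_i (t - d i)).
    by apply/matrixP => i j; rewrite !mxE; case: eqP => _;
    rewrite ?mulr1n ?mulr0n ?mulr1 ?mulr0 ?subr0.
  by rewrite det_diag; apply: eq_bigr => i _; rewrite !hornerE mxE.
rewrite !det_mulmx det_tr; apply: (canLR (mulfK G0)).
by rewrite -[LHS]mulr1 -dG; ring.
Qed.

Lemma square_difference_sum (A B : 'M[R]_n) (s : R) : s ^+ 2 = 1 ->
  \sum_i \sum_j (s * A i j - B i j) ^+ 2 =
  \sum_i \sum_j A i j * A i j + \sum_i \sum_j B i j * B i j
   - 2 * (s * \sum_i \sum_j A i j * B i j).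
Proof.
move=> s2; rewrite !mulr_sumr -big_split -sumrB /=; apply: eq_bigr => i _.
rewrite !mulr_sumr -big_split -sumrB /=; apply: eq_bigr => j _.
by rewrite sqrrB exprMn s2 mul1r -!expr2; ring.
Qed.

End Frames.

Import Pilot.Defs.

Section ImmersedManifold.
Local Open Scope classical_set_scope.
Variables (R : realType) (n : nat) (M : smoothManifold R n) (g : riemannianMetric M).
Variables (c : R) (f : M -> 'rV[R]_n.+2).
Hypothesis himm : isometric_immersion (m := n.+1) g c f.

Let E := ambient_form n.+1 c.
Let U (a : chart M) := coord a @` dom a.
Let F (a : chart M) := f \o param a.
Let S a y N := shape_form c (F a) y N.

Let oU a : open (U a). Proof. exact: coord_open. Qed.
Let smF a : smooth_on (U a) (F a). Proof. by case: himm => _ /(_ a)[]. Qed.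
Local Arguments oU : clear implicits.
Local Arguments smF : clear implicits.

Let FQ a y : U a y -> space_form n.+1 c (F a y).
Proof. by move=> _; case: himm => h _; exact: h. Qed.

Let GE a y : U a y -> forall i j, g a y i j = bform E (partial (F a) i y) (partial (F a) j y).
Proof.
move=> Uy i j; have [_ /(_ a)[sm /(_ y Uy)[_ <-]]] := himm.
have dF := smooth_differentiable sm Uy.
have e k : partial (F a) k y = row k ('J (f \o param a) y).
  by rewrite /partial deriveEjacobian // rowE.
by rewrite !e bform_rowr -!row_mul [RHS]mxE.
Qed.

Let unitG a y : U a y -> g a y \in unitmx.
Proof. move=> Uy; apply: posdef_unit; exact: metric_posdef. Qed.

Let symG a y : U a y -> (g a y)^T = g a y.
Proof. exact: metric_sym. Qed.

Let lowered a y N (Uy : U a y) (hN : unit_normal c (F a) y N) i j k m :=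
  lowered_riemann (oU a) (smF a) (@FQ a) (@GE a) (@unitG a) i j k m Uy hN.

(** The rows of [P] are an orthonormal basis of principal directions, in the
    coordinates of the chart [a], and [d] lists the principal curvatures. *)
Definition frame_at (p : M) (a : chart M) (N : 'rV[R]_n.+2) (P : 'M[R]_n) (d : 'I_n -> R) :=
  [/\ unit_normal c (F a) (coord a p) N,
      P *m g a (coord a p) *m P^T = 1%:M &
      P *m S a (coord a p) N *m P^T = diag_mx (\row_i d i)].

Definition spectrum_at (p : M) (d : 'I_n -> R) :=
  exists a N P, dom a p /\ frame_at p a N P d.

Let UcoordP a p : dom a p -> U a (coord a p).
Proof. by move=> ap; exists p. Qed.

Lemma exists_spectrum p : exists d, spectrum_at p d.
Proof.
have [a ap] := dom_cover p; have Uy := UcoordP ap.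
have [N hN] := exists_chart_normal (@FQ a) Uy.
have pG : posdef (g a (coord a p)) by move=> v; exact: metric_posdef.
have [P [d [PG PS]]] := simultaneous_diagonalization (symG Uy)
  (shape_form_sym c (oU a) (smF a) N Uy) pG.
exists (fun i => d 0 i), a, N, P; split=> //; split=> //.
by rewrite PS; congr diag_mx; apply/rowP => i; rewrite mxE.
Qed.

Lemma overlap_open (a b : chart M) : open (coord a @` (dom a `&` dom b)).
Proof.
rewrite openE => _ [p [ap bp] <-]; rewrite /interior.
have Uy := UcoordP ap.
have h1 := open_nbhs_nbhs (conj (oU a) Uy).
have h2 : nbhs (coord a p) (param a @^-1` dom b).
  apply: (param_continuous Uy); rewrite coordK //.
  by apply: open_nbhs_nbhs; split=> //; exact: dom_open.
apply: filterS (filterI h1 h2) => _ [[q aq <-] /=].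
by rewrite coordK // => bq; exists q.
Qed.

(** The second fundamental form is a tensor: under a change of charts with
    Jacobian matrix J it becomes J S J^T, like the metric, for the same normal. *)
Lemma spectrum_in_chart p d b : spectrum_at p d -> dom b p ->
  exists N P, frame_at p b N P d.
Proof.
move=> [a [N [P [ap [[NN Nnu NT] PG PS]]]]] bp.
pose tau := coord a \o param b; pose O := coord b @` (dom b `&` dom a).
have Oy : O (coord b p) by exists p.
set y := coord b p in Oy *.
have ty : tau y = coord a p by rewrite /tau /= /y coordK.
have oO : open O by exact: overlap_open.
have smT : smooth_on O tau by exact: transition_smooth.
have tU z : O z -> U a (tau z).
  by move=> [q [bq aq] <-]; rewrite /tau /= coordK //; exact: UcoordP.
have FE z : O z -> F b z = F a (tau z).
  by move=> [q [bq aq] <-]; rewrite /F /tau /= !coordK.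
have Uy : U b y by exact: UcoordP.
pose J : 'M[R]_n := \matrix_i partial tau i y.
have JE : 'J tau y = J.
  apply/row_matrixP => i; rewrite rowK rowE /partial deriveEjacobian //.
  exact: smooth_differentiable smT Oy.
have GJ : g b y = J *m g a (coord a p) *m J^T.
  by rewrite -JE -ty; exact: (metric_transition g Oy).
have uJ : J \in unitmx.
  have : J *m (g a (coord a p) *m J^T *m invmx (g b y)) = 1%:M.
    by rewrite !mulmxA -GJ mulmxV // unitG.
  by move=> /mulmx1_unit[].
have bsum (I : finType) (u : I -> 'rV[R]_n.+2) :
    bform E (\sum_i u i) N = \sum_i bform E (u i) N.
  by rewrite /bform !mulmx_suml summxE.
have SJ : S b y N = J *m S a (coord a p) N *m J^T.
  apply/matrixP => i j; rewrite !mxE.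
  have dF : differentiable (partial (F b) j) y.
    exact: smooth_differentiable (smooth_derive 'e_j (smF b)) Uy.
  rewrite (partial2_comp oO smT (smF a) tU FE i dF Oy) ty bsum.
  apply: eq_bigr => k _; rewrite bformDl bformZl NT mulr0 add0r bformZl bsum.
  rewrite !mxE mulrC; congr (_ * _); apply: eq_bigr => l _.
  by rewrite bformZl !mxE.
exists N, (P *m invmx J); split.
- split; first exact: NN.
    have Fe : F b y = F a (coord a p) by rewrite FE // ty.
    exact: (etrans (congr1 (fun w => bform E N (position_normal c w)) Fe) Nnu).
  move=> i; rewrite (partial_comp oO smT (smF a) tU FE i Oy) ty bsum big1 // => k _.
  by rewrite bformZl NT mulr0.
- rewrite -/y GJ trmx_mul trmx_inv !mulmxA mulmxKV // -[_ *m J^T *m _]mulmxA.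
  by rewrite mulmxV ?unitmx_tr // mulmx1.
- rewrite -/y SJ trmx_mul trmx_inv !mulmxA mulmxKV // -[_ *m J^T *m _]mulmxA.
  by rewrite mulmxV ?unitmx_tr // mulmx1.
Qed.

(** The isometry maps principal directions to principal directions, permuted so
    that the products of principal curvatures correspond. *)
Lemma same_type_isometry p q a b N P N' P' d d' : dom a p -> dom b q ->
  frame_at p a N P d -> frame_at q b N' P' d' -> curv_equiv d d' ->
  exists J : 'M[R]_n,
    (forall u v, bform (g b (coord b q)) (u *m J) (v *m J)
               = bform (g a (coord a p)) u v) /\
    (forall u v w z,
       curvature_tensor (g b) (coord b q) (u *m J) (v *m J) (w *m J) (z *m J)
       = curvature_tensor (g a) (coord a p) u v w z).
Proof.
move=> ap bq [hN PG PS] [hN' PG' PS'] [s hs].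
have uP := frame_unit PG.
have dd1 : (1%:M : 'M[R]_n) = diag_mx (\row_i (fun=> 1) i).
  by apply/matrixP => i j; rewrite !mxE.
exists (invmx P *m perm_mx s *m P').
have old (B : 'M[R]_n) e u v : P *m B *m P^T = diag_mx (\row_i e i) ->
    bform B u v = \sum_i e i * (u *m invmx P) 0 i * (v *m invmx P) 0 i.
  by move=> h; rewrite -(bform_frame _ _ h) !mulmxKV.
have new (B : 'M[R]_n) e u v : P' *m B *m P'^T = diag_mx (\row_i e i) ->
    bform B (u *m (invmx P *m perm_mx s *m P')) (v *m (invmx P *m perm_mx s *m P'))
    = \sum_i e (s i) * (u *m invmx P) 0 i * (v *m invmx P) 0 i.
  move=> h; rewrite !mulmxA (bform_frame _ _ h) (reindex_perm s) /=.
  by apply: eq_bigr => i _; rewrite !perm_mx_coord.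
rewrite dd1 in PG PG'.
have gE u v : bform (g b (coord b q)) (u *m (invmx P *m perm_mx s *m P'))
    (v *m (invmx P *m perm_mx s *m P')) = bform (g a (coord a p)) u v.
  by rewrite (new _ _ _ _ PG') (old _ _ _ _ PG).
split=> // u v w z.
rewrite (curvature_tensorE (lowered (UcoordP bq) hN')).
rewrite (curvature_tensorE (lowered (UcoordP ap) hN)) !gE; congr (_ + _).
rewrite !(new _ _ _ _ PS') !(old _ _ _ _ PS).
apply: esym; apply: curvature_products => i j; exact: hs.
Qed.

Hypothesis hric : constant_ricci_eigenvalues g.

(** The multiplicity of x + (n - 1) c as Ricci eigenvalue is the number of
    indices i with mu_i = x. *)
Lemma spectra_ricci_part p q d d' : spectrum_at p d -> spectrum_at q d' ->
  exists s : {perm 'I_n}, forall i, ricci_part d i = ricci_part d' (s i).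
Proof.
move=> [a [N [P [ap [hN PG PS]]]]] [b [N' [P' [bq [hN' PG' PS']]]]].
have Ux := UcoordP ap; have Uy := UcoordP bq.
have h lam := hric ap bq lam.
apply: perm_eq_codom; apply/allP => x _ /=; apply/eqP.
have := h (x + c * (n%:R - 1)).
rewrite (rank_eigenspace_ricci (lowered Ux hN) (unitG Ux) (symG Ux) PG PS).
rewrite (rank_eigenspace_ricci (lowered Uy hN') (unitG Uy) (symG Uy) PG' PS').
have cnt e : #|finset (fun i => ricci_part e i + c * (n%:R - 1) == x + c * (n%:R - 1))|
    = count_mem x (codom (ricci_part e)).
  rewrite codomE count_map -size_filter cardE; congr size.
  rewrite [in RHS]enumT; apply: eq_filter => i.
  rewrite inE /= finset.in_set; apply/idP/idP => /eqP eqe; apply/eqP; first exact: addIr eqe.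
  by rewrite eqe.
by rewrite !cnt.
Qed.

(** The products S_ij S_kl = [K i j k l] are continuous, although the normal, and
    with it the sign of S, is chosen separately at each point.  If the sign at y
    is such that (S, S0) >= 0 then |S - S0|^2 = |S|^2 + |S0|^2 - 2 |(S, S0)|, and
    this is the continuous function [D], as (S, S0)^2 = [Q] involves products
    only.  So the characteristic polynomial of S or - S is near the one of S0,
    and [locally_unique_type] applies. *)
Lemma spectrum_locally_constant p d : (2 <= n)%N -> spectrum_at p d ->
  \forall r \near p, forall d', spectrum_at r d' -> curv_equiv d d'.
Proof.
move=> n2 hs.
have [T [e [e0 hT]]] := locally_unique_type d n2.
have [a ap] := dom_cover p.
have [N0 [P0 [hN0 PG0 PS0]]] := spectrum_in_chart hs ap.
set x := coord a p in hN0 PG0 PS0.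
have Ux : U a x by exact: UcoordP.
pose S0 := S a x N0; pose G0 := g a x.
have [r r0 hr] := det_quotients_near S0 T (unitG Ux) e0.
pose K i j k l y := gauss_term E (F a) (g a) y i j k l - c * (g a y i j * g a y k l).
have KE y N i j k l : U a y -> unit_normal c (F a) y N ->
    K i j k l y = S a y N i j * S a y N k l.
  move=> Uy hN; rewrite /K.
  rewrite (gauss_term_shape (oU a) (smF a) (@FQ a) (@GE a) (@unitG a) _ _ _ _ Uy hN).
  by rewrite addrK.
pose Q y := \sum_i \sum_j \sum_k \sum_l S0 i j * S0 k l * K i j k l y.
pose D y := \sum_i \sum_j K i j i j y + \sum_i \sum_j S0 i j * S0 i j - 2 * Num.sqrt (Q y).
pose C (h : 'rV[R]_n -> R) := {for x, continuous h}.
have Ccst (k : R) : C (fun=> k) by exact: cst_continuous.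
have Cadd (h k : 'rV[R]_n -> R) : C h -> C k -> C (fun y => h y + k y) by exact: continuousD.
have Cmul (h k : 'rV[R]_n -> R) : C h -> C k -> C (fun y => h y * k y) by exact: continuousM.
have Csub (h k : 'rV[R]_n -> R) : C h -> C k -> C (fun y => h y - k y) by exact: continuousB.
have Cg i j : C (fun y => g a y i j).
  exact: smooth_continuous_coord (metric_smooth g a) Ux.
have CK i j k l : C (K i j k l).
  apply: Csub; last by apply: (Cmul _ _); [exact: Ccst|exact: Cmul].
  exact: (continuous_gauss_term (oU a) (smF a) (@GE a) (@unitG a)).
have Csum (I : Type) (t : seq I) h : (forall i, C (h i)) -> C (fun y => \sum_(i <- t) h i y).
  exact: closed_sum.
have CQ : C Q.
  apply: (Csum _ _ _) => i; apply: (Csum _ _ _) => j; apply: (Csum _ _ _) => k.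
  by apply: (Csum _ _ _) => l; apply: (Cmul _ _).
have CD : C D.
  apply: (Csub _ _).
    apply: (Cadd _ _); last exact: Ccst.
    by apply: (Csum _ _ _) => i; apply: (Csum _ _ _) => j.
  apply: (Cmul _ _); first exact: Ccst.
  apply: (@continuous_comp _ _ _ Q Num.sqrt x) => //; exact: sqrt_continuous.
have QE y N : U a y -> unit_normal c (F a) y N ->
    Q y = (\sum_i \sum_j S a y N i j * S0 i j) ^+ 2.
  move=> Uy hN; rewrite expr2 big_distrl; apply: eq_bigr => i _ /=.
  rewrite big_distrl; apply: eq_bigr => j _ /=.
  rewrite mulr_sumr; apply: eq_bigr => k _; rewrite mulr_sumr; apply: eq_bigr => l _.
  by rewrite (KE _ N) //; ring.
have DE y N : U a y -> unit_normal c (F a) y N ->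
    D y = \sum_i \sum_j S a y N i j * S a y N i j + \sum_i \sum_j S0 i j * S0 i j
      - 2 * `|\sum_i \sum_j S a y N i j * S0 i j|.
  move=> Uy hN; rewrite /D (QE _ N) // sqrtr_sqr; congr (_ + _ - _).
  by apply: eq_bigr => i _; apply: eq_bigr => j _; rewrite (KE _ N).
have D0 : D x = 0.
  rewrite (DE _ N0) // ger0_norm; first by rewrite -/S0; ring.
  by apply: sumr_ge0 => i _; apply: sumr_ge0 => j _; rewrite -/S0 -expr2 sqr_ge0.
have near_y : \forall y \near x, [/\ U a y, forall i j, `|g a y i j - G0 i j| < r &
    `|D y| < r ^+ 2].
  have ny1 : \forall y \near x, U a y by apply: open_nbhs_nbhs.
  have ny2 := near_values (fun ij : 'I_n * 'I_n => Cg ij.1 ij.2) r0.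
  have ny3 := near_value CD (exprn_gt0 2 r0).
  rewrite D0 in ny3.
  have ny2' : \forall y \near x, forall i j, `|g a y i j - G0 i j| < r.
    by move: ny2; apply: filterS => y hy i j; exact: (hy (i, j)).
  have ny3' : \forall y \near x, `|D y| < r ^+ 2.
    by move: ny3; apply: filterS => y; rewrite subr0.
  exact: near_and3 ny1 ny2' ny3'.
have near_r : \forall q \near p, dom a q /\ [/\ U a (coord a q),
    forall i j, `|g a (coord a q) i j - G0 i j| < r & `|D (coord a q)| < r ^+ 2].
  apply: filterI; first by apply: open_nbhs_nbhs; split=> //; exact: dom_open.
  exact: (coord_continuous ap near_y).
apply: filterS near_r => q [aq [Uy hg hD]] d' hd'.
have [N [P [hN PG PS]]] := spectrum_in_chart hd' aq.
set y := coord a q in Uy hg hD hN PG PS.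
pose t := \sum_i \sum_j S a y N i j * S0 i j.
have [s s2 st] : exists2 s : R, s = 1 \/ s = -1 & s * t = `|t|.
  have [t0|t0] := leP 0 t; first by exists 1; [left|rewrite mul1r ger0_norm].
  by exists (-1); [right|rewrite mulN1r ltr0_norm].
have s21 : s ^+ 2 = 1 by case: s2 => ->; rewrite ?sqrrN expr1n.
have hS i j : `|(s *: S a y N) i j - S0 i j| < r.
  have sum0 : \sum_i \sum_j (s * S a y N i j - S0 i j) ^+ 2 < r ^+ 2.
    rewrite square_difference_sum // -/t st -(DE _ N) //.
    exact: le_lt_trans (ler_norm _) hD.
  rewrite mxE -(ltr_pXn2r (n := 2)) ?nnegrE ?normr_ge0 ?ltW // real_normK ?num_real //.
  apply: le_lt_trans sum0; rewrite (bigD1 i) //= (bigD1 j) //= -addrA lerDl.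
  by rewrite addr_ge0 // sumr_ge0 // => k _; rewrite ?sumr_ge0 // => *; exact: sqr_ge0.
have PSs : P *m (s *: S a y N) *m P^T = diag_mx (\row_i (s * d' i)).
  rewrite -scalemxAr -scalemxAl PS; apply/matrixP => i j.
  by rewrite !mxE mulrnAr.
have [s' hs'] := spectra_ricci_part hs hd'.
have : curv_equiv d (fun i => s * d' i).
  apply: (hT _ s') => [i|u uT].
    rewrite hs' /ricci_part; have -> : trace (fun i => s * d' i) = s * trace d'.
      by rewrite /trace mulr_sumr.
    by rewrite -mulrBr mulrACA -expr2 s21 mul1r.
  have := hr _ _ hS hg _ uT; rewrite (det_frame u PG PSs).
  by rewrite (det_frame u PG0 PS0).
move=> [s1 hs1]; exists s1 => i j ij; rewrite hs1 // mulrACA -expr2 s21 mul1r //.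
Qed.

(** The points of the type of p form a set that is open, and closed since each
    other type is also open. *)
Lemma same_type_everywhere p q d d' : (2 <= n)%N -> connected [set: M] ->
  spectrum_at p d -> spectrum_at q d' -> curv_equiv d d'.
Proof.
move=> n2 conn hd hd'.
pose C := [set r | forall e, spectrum_at r e -> curv_equiv d e].
suff CT : C = [set: M] by have Cq : C q by [rewrite CT]; exact: Cq hd'.
apply: conn.
- exists p => e; exact: (nbhs_singleton (spectrum_locally_constant n2 hd)).
- exists C; last by rewrite setTI.
  rewrite openE => r Cr; have [e1 he1] := exists_spectrum r.
  apply: filterS (spectrum_locally_constant n2 he1) => r' h e he.
  exact: curv_equiv_trans (Cr _ he1) (h _ he).
- exists C; last by rewrite setTI.
  rewrite -[C]setCK; apply: open_closedC; rewrite openE => r nCr.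
  have [e1 he1 ne1] : exists2 e1, spectrum_at r e1 & ~ curv_equiv d e1.
    apply: contrapT => hn; apply: nCr => e he; apply: contrapT => ne.
    by apply: hn; exists e.
  apply: filterS (spectrum_locally_constant n2 he1) => r' h Cr'; apply: ne1.
  have [e he] := exists_spectrum r'.
  exact: curv_equiv_trans (Cr' _ he) (curv_equiv_sym (h _ he)).
Qed.

Lemma immersed_curvature_homogeneous : (2 <= n)%N -> connected [set: M] ->
  curvature_homogeneous g.
Proof.
move=> n2 conn p q a b ap bq.
have [d hd] := exists_spectrum p; have [d' hd'] := exists_spectrum q.
have [N [P hP]] := spectrum_in_chart hd ap; have [N' [P' hP']] := spectrum_in_chart hd' bq.
exact: same_type_isometry ap bq hP hP' (same_type_everywhere n2 conn hd hd').
Qed.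

End ImmersedManifold.

Unset Implicit Arguments.
Local Open Scope classical_set_scope.

Theorem corollary1p2 (R : realType) (n : nat) (hn : (4 <= n)%N)
    (M : smoothManifold R n) (g : riemannianMetric M)
    (hconn : connected [set: M])
    (hric : constant_ricci_eigenvalues g)
    (hnch : ~ curvature_homogeneous g)
    (c : R) :
  ~ exists f : M -> 'rV[R]_(n.+1).+1, isometric_immersion (m := n.+1) g c f.
Proof.
move=> [f himm]; apply: hnch.
exact: (immersed_curvature_homogeneous himm hric (leq_trans (isT : (2 <= 4)%N) hn) hconn).
Qed.
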